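(* Fix an integer $k\ge 1$, and let $Y$ be a random graph chosen from $\mathcal{G}(n,p)$. The threshold probability guaranteeing the connectedness of the friends-and-strangers graph $\mathsf{FS}(K_{k,n-k},Y)$ is $$p_0=\bigl(1+o(1)\bigr)\frac{\log n}{n}\qquad (n\to\infty).$$ That is, for every fixed $\varepsilon>0$ and every sequence $p=p(n)\in[0,1]$: if $p(n)\le (1-\varepsilon)\frac{\log n}{n}$ for all sufficiently large $n$, then the probability that $\mathsf{FS}(K_{k,n-k},Y)$ is disconnected tends to $1$ as $n\to\infty$; and if $p(n)\ge (1+\varepsilon)\frac{\log n}{n}$ for all sufficiently large $n$, then the probability that $\mathsf{FS}(K_{k,n-k},Y)$ is connected tends to $1$ as $n\to\infty$.
   Context: All graphs are finite and simple, without loops. $\mathcal{G}(n,p)$ denotes the Erdős–Rényi random graph on $n$ vertices in which each edge is chosen independently with probability $p$. $\log$ is the natural logarithm. $K_{k,n-k}$ is the complete bipartite graph with parts of sizes $k$ and $n-k$ (considered for $n\ge 2k$). Friends-and-strangers graph: for graphs $X,Y$ each with $n$ vertices, $\mathsf{FS}(X,Y)$ is the graph whose vertices are all bijections $\sigma:V(X)\to V(Y)$; two bijections $\sigma,\sigma'$ are adjacent if and only if there is an edge $ab\in E(X)$ such that $\sigma(a)\sigma(b)\in E(Y)$, $\sigma(a)=\sigma'(b)$, $\sigma(b)=\sigma'(a)$, and $\sigma(c)=\sigma'(c)$ for all $c\in V(X)\setminus\{a,b\}$. *)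

(* Defs.v *)
From HB Require Import structures.
From mathcomp Require Import all_boot all_order all_algebra all_fingroup.
Set Implicit Arguments.
Unset Strict Implicit.
Unset Printing Implicit Defensive.
Import GRing.Theory.

Definition vpairs (T : finType) : {set {set T}} := [set e : {set T} | #|e| == 2].

(* A simple graph on T is its set of edges, unordered pairs of distinct vertices. *)
Record sgraph (T : finType) := SGraph {
  edges : {set {set T}};
  edges_sub : edges \subset vpairs T }.

HB.instance Definition _ (T : finType) := [isSub for @edges T].
HB.instance Definition _ (T : finType) := [Finite of sgraph T by <:].

Definition adj (T : finType) (G : sgraph T) : rel T :=
  fun x y => [set x; y] \in edges G.

Section GraphOfRel.
Variables (T : finType) (e : rel T).
Hypotheses (e_sym : symmetric e) (e_irr : irreflexive e).

Definition rel_edges : {set {set T}} :=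
  [set [set u.1; u.2] | u : T * T & e u.1 u.2].

Lemma rel_edges_sub : rel_edges \subset vpairs T.
Proof.
apply/subsetP => _ /imsetP[[x y] /= exy ->].
rewrite inE cards2; move: exy; rewrite inE /=.
by case: (eqVneq x y) => [->|//]; rewrite e_irr.
Qed.

Definition graph_of_rel : sgraph T := SGraph rel_edges_sub.

Lemma adj_graph_of_rel : adj graph_of_rel =2 e.
Proof.
move=> x y; apply/imsetP/idP => [[[a b] + /= eq_xy]|exy]; last first.
  by exists (x, y); rewrite ?inE.
rewrite inE /= => eab.
have neab : a != b by apply: contraTneq eab => ->; rewrite e_irr.
have /set2P[xE|xE] : x \in [set a; b] by rewrite -eq_xy set21.
  have /set2P[bx|<-] : b \in [set x; y] by rewrite eq_xy set22.
    by rewrite bx xE eqxx in neab.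
  by rewrite xE.
have /set2P[ax|<-] : a \in [set x; y] by rewrite eq_xy set21.
  by rewrite ax xE eqxx in neab.
by rewrite xE e_sym.
Qed.

End GraphOfRel.

Definition gconnected (T : finType) (G : sgraph T) : bool :=
  [forall x, forall y, connect (adj G) x y].

(* The bipartition classes are {0, ..., k-1} and {k, ..., n-1}; they have      *)
(* sizes k and n - k as soon as k <= n.                                       *)
Definition Kbip_rel (k n : nat) : rel 'I_n := fun x y => (x < k) != (y < k).

Lemma Kbip_rel_irr k n : irreflexive (@Kbip_rel k n).
Proof. by move=> x; rewrite /Kbip_rel eqxx. Qed.

Definition Kbip (k n : nat) : sgraph 'I_n := graph_of_rel (@Kbip_rel_irr k n).

Lemma adj_Kbip k n (x y : 'I_n) : adj (Kbip k n) x y = ((x < k) != (y < k)).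
Proof.
by apply: adj_graph_of_rel => {}x {}y; rewrite /Kbip_rel eq_sym.
Qed.

(* Both graphs live on the same vertex type T, so that the bijections         *)
(* V(X) -> V(Y) are the permutations of T.                                    *)
Section FriendsAndStrangers.
Variables (T : finType) (X Y : sgraph T).

Definition FS_rel : rel {perm T} := fun s s' =>
  [exists a, exists b,
    [&& adj X a b, adj Y (s a) (s b), s a == s' b, s b == s' a &
        [forall c, (c \notin [set a; b]) ==> (s c == s' c)]]].

Lemma adj_irr (G : sgraph T) : irreflexive (adj G).
Proof.
move=> x; apply/negP => /(subsetP (edges_sub G)).
by rewrite inE setUid cards1.
Qed.

Lemma adj_sym (G : sgraph T) : symmetric (adj G).
Proof. by move=> x y; rewrite /adj setUC. Qed.

Lemma FS_rel_irr : irreflexive FS_rel.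
Proof.
move=> s; rewrite /FS_rel; apply/existsP => -[a /existsP[b /and5P[_ Yab /eqP sab _ _]]].
by move: Yab; rewrite sab adj_irr.
Qed.

Lemma FS_rel_sym : symmetric FS_rel.
Proof.
suff imp s s' : FS_rel s s' -> FS_rel s' s.
  by move=> s s'; apply/idP/idP; exact: imp.
rewrite /FS_rel => /existsP[a /existsP[b]].
move=> /and5P[Xab Yab /eqP sab /eqP sba /forallP sc].
apply/existsP; exists a; apply/existsP; exists b.
rewrite Xab -sab -sba adj_sym Yab !eqxx /=.
by apply/forallP => c; rewrite eq_sym.
Qed.

Definition FS : sgraph {perm T} := graph_of_rel FS_rel_irr.

Lemma adj_FS : adj FS =2 FS_rel.
Proof. exact: adj_graph_of_rel FS_rel_sym FS_rel_irr. Qed.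

End FriendsAndStrangers.

Local Open Scope ring_scope.

Section ErdosRenyi.
Variables (R : comNzRingType) (n : nat).

(* Probability of the outcome G when each unordered pair is kept independently *)
(* with probability p; a probability only for 0 <= p <= 1.                     *)
Definition gnp_weight (p : R) (G : sgraph 'I_n) : R :=
  \prod_(e in vpairs 'I_n) (if e \in edges G then p else 1 - p).

Definition gnp_prob (p : R) (A : pred (sgraph 'I_n)) : R :=
  \sum_(G : sgraph 'I_n | A G) gnp_weight p G.

Lemma gnp_prob_total (p : R) : gnp_prob p predT = 1.
Proof.
have -> : gnp_prob p predT =
  \sum_(E in powerset (vpairs 'I_n))
    \prod_(e in vpairs 'I_n) (if e \in E then p else 1 - p).
  rewrite /gnp_prob.
  rewrite [RHS](reindex_omap (@edges 'I_n) insub) /=; last first.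
    by move=> E; rewrite inE => sE; rewrite insubT.
  apply: eq_big => [G|//].
  by rewrite inE (edges_sub G) /= valK eqxx.
pose F (e : {set 'I_n}) := if e \in vpairs 'I_n then p else 0.
pose G (e : {set 'I_n}) := if e \in vpairs 'I_n then 1 - p else 1.
transitivity (\prod_e (F e + G e)); last first.
  by apply: big1 => e _; rewrite /F /G; case: ifP; rewrite ?add0r // addrC subrK.
have -> : \prod_e (F e + G e) =
    \sum_(E : {set {set 'I_n}}) \prod_e (if e \in E then F e else G e).
  exact: bigA_distr.
rewrite [RHS](bigID (fun E : {set {set 'I_n}} => E \subset vpairs 'I_n)) /=.
rewrite [X in _ = _ + X]big1 ?addr0 => [|E /subsetPn[e eE /negPf eP]]; last first.
  by rewrite (bigD1 e) //= eE /F eP mul0r.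
apply: eq_big => [E|E]; rewrite inE // => /subsetP sE.
rewrite big_mkcond; apply: eq_bigr => e _; rewrite /F /G.
by case: ifP => // /negP eP; case: ifP => // /sE.
Qed.

End ErdosRenyi.

(* Main.v *)
(** Both graphs are read as positions and tokens: a vertex of [K_{k,n-k}] is a token standing on a
    vertex of [Y], and tokens of different classes on adjacent positions may be swapped.

    If [Y] has an isolated vertex then whatever stands there never moves; below the threshold there
    is one with high probability, by the second moment method.

    If [Y] is 2-connected and contains a triangle, then the graph is connected. For [k = 1], let a
    set [W] of positions be good if any two tiles on [W] can be exchanged whenever the blank is on
    [W]. The triangle is good. If [W] is good and [x] outside [W] is adjacent to [w] in [W], let the
    blank go from [w] to [x] and return to [W] outside [W] through some vertex other than [w]: the
    tile of [x] is now on [w] while a third tile of [W] has not moved, so [x] can be added to [W].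
    For general [k], walk one token [c] as if it were the only one of its class; when it meets a
    token of its class, relabelling that class replaces the forbidden swap. Hence any two tokens of the
    other class can be brought, with some token of the class of [c], to the triangle, exchanged
    there, and brought back.

    Above the threshold, [Y] is 2-connected by a union bound over the smaller side of a cut, and
    contains a triangle by the second moment method; all error terms are O(1 / log n). *)
Require Import Defs.
From mathcomp Require Import all_boot all_order all_algebra all_fingroup.
From mathcomp Require Import ring lra zify.
Set Implicit Arguments.
Unset Strict Implicit.
Unset Printing Implicit Defensive.

(** * Moves of tokens *)

Section FSMoves.
Variables (T : finType) (X Y : sgraph T).
Local Notation reach := (connect (adj (FS X Y))).

(** Products of permutations act from left to right, so [tperm a b * s] first exchanges the names of
    the tokens [a] and [b] and then places them by [s]. *)
Lemma FS_adjP (s t : {perm T}) :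
  reflect (exists a b, [/\ adj X a b, adj Y (s a) (s b) & t = (tperm a b * s)%g])
          (adj (FS X Y) s t).
Proof.
rewrite adj_FS; apply: (iffP existsP) => [[a /existsP[b]]|[a [b [Xab Yab ->]]]].
  move=> /and5P[Xab Yab /eqP sab /eqP sba /forallP stc].
  exists a, b; split=> //; apply/permP => c; rewrite permM.
  case: tpermP => [->|->|/eqP ca /eqP cb]; rewrite ?sab ?sba //.
  by have := stc c; rewrite !inE negb_or ca cb => /eqP.
exists a; apply/existsP; exists b; rewrite Xab Yab !permM tpermL tpermR !eqxx.
apply/forallP => c; rewrite !inE negb_or; apply/implyP => /andP[ca cb].
by rewrite permM tpermD // eq_sym.
Qed.

Lemma FS_step (s : {perm T}) (a b : T) :
  adj X a b -> adj Y (s a) (s b) -> reach s (tperm a b * s)%g.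
Proof. by move=> Xab Yab; apply/connect1/FS_adjP; exists a, b. Qed.

Lemma FS_reach_sym : connect_sym (adj (FS X Y)).
Proof. exact/sym_connect_sym/adj_sym. Qed.

(** Left multiplication by [pi] renames the tokens. An automorphism of [X] keeps every swap legal,
    so a whole route can be replayed under new names. *)
Lemma FS_reach_aut (pi s t : {perm T}) :
  {mono pi : a b / adj X a b} -> reach s t -> reach (pi * s)%g (pi * t)%g.
Proof.
move=> piX /connectP[l sl ->] {t}; elim: l s sl => [|t l IHl] s /=.
  by rewrite connect0.
case/andP => /FS_adjP[a [b [Xab Yab ->]]] /IHl; apply: connect_trans.
have -> : (pi * (tperm a b * s))%g =
    (tperm ((pi^-1)%g a) ((pi^-1)%g b) * (pi * s))%g.
  by rewrite -tpermJ conjgE invgK !mulgA mulgKV.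
by apply: FS_step; [rewrite -piX !permKV | rewrite !permM !permKV].
Qed.

(* On a triangle of [Y], conjugating the swap of [c] and [j] by that of [c]   *)
(* and [i] swaps [i] and [j].                                                 *)
Lemma FS_triangle_swap (s : {perm T}) (c i j : T) :
    adj X c i -> adj X c j -> i != j ->
    adj Y (s c) (s i) -> adj Y (s c) (s j) -> adj Y (s i) (s j) ->
  reach s (tperm i j * s)%g.
Proof.
move=> Xci Xcj neq_ij Yci Ycj Yij.
have neq_ci : c != i by apply: contraTneq Xci => ->; rewrite adj_irr.
have neq_cj : c != j by apply: contraTneq Xcj => ->; rewrite adj_irr.
have -> : (tperm i j * s = tperm c i * (tperm c j * (tperm c i * s)))%g.
  rewrite !mulgA; congr (_ * s)%g.
  rewrite -{1}(tpermV c i) -mulgA -conjgE tpermJ tpermL tpermD // eq_sym //.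
apply: connect_trans (FS_step Xci Yci) _.
apply: connect_trans (FS_step (s := (tperm c i * s)%g) Xcj _) _.
  by rewrite !permM tpermL tpermD // eq_sym.
apply: FS_step Xci _; rewrite !permM.
rewrite tpermL (tpermD neq_cj neq_ij) (tpermD neq_ci) ?tpermR 1?adj_sym //; by rewrite eq_sym.
Qed.

(** Splitting off [tperm x (pi x)] on the left leaves a permutation that fixes [pi x] and moves no
    new point, so the number of moved points drops. *)
Lemma FS_reach_perm_on (D : {set T}) :
    (forall s i j, i \in D -> j \in D -> i != j -> reach s (tperm i j * s)%g) ->
  forall pi s, perm_on D pi -> reach s (pi * s)%g.
Proof.
move=> swapD pi s; have [m le_m] := ubnP #|[pred x | pi x != x]|.
elim: m => // m IHm in pi s le_m *; move=> pi_on.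
have [x /= pix|fix_pi] := pickP [pred x | pi x != x]; last first.
  suff -> : pi = 1%g by rewrite mul1g connect0.
  by apply/permP => x; rewrite perm1; apply/eqP/negbFE/fix_pi.
have xD : x \in D by apply: contraR pix => /(out_perm pi_on)->.
have pixD : pi x \in D by rewrite (perm_closed _ pi_on).
pose rho := (tperm x (pi x) * pi)%g.
have -> : (pi * s = tperm x (pi x) * (rho * s))%g.
  by rewrite /rho !mulgA tperm2 mul1g.
apply: connect_trans (swapD _ _ _ xD pixD _); last by rewrite eq_sym.
apply: IHm => //; last first.
  apply: perm_onM => //; apply/subsetP => y; rewrite inE.
  by apply: contraR => yD; apply/eqP/tpermD; apply: contraNneq yD => <-.
rewrite -ltnS (leq_trans _ le_m) // ltnS; apply: proper_card.
have pipix : pi (pi x) != pi x by rewrite (inj_eq perm_inj).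
apply/properP; split; last first.
  by exists (pi x); rewrite !inE ?permM ?tpermR ?eqxx.
apply/subsetP => y; rewrite !inE permM; apply: contraNneq => piy.
have neq_xy : x != y by apply: contraNneq pix => ->; apply/eqP.
have neq_pixy : pi x != y by apply: contraNneq pipix => ->; apply/eqP.
by rewrite tpermD ?piy.
Qed.
End FSMoves.

(** * Induced reachability, triangles and 2-connectedness *)

Definition induced (T : finType) (G : sgraph T) (U : {set T}) : rel T :=
  fun a b => [&& adj G a b, a \in U & b \in U].

Definition triangle (T : finType) (G : sgraph T) (t1 t2 t3 : T) : bool :=
  [&& adj G t1 t2, adj G t1 t3 & adj G t2 t3].

(* For at least three vertices this says that [G] is 2-connected.            *)
Definition cut_free (T : finType) (G : sgraph T) : Prop :=
  forall (v : T) (S : {set T}), S != set0 -> v \notin S -> v |: S != setT ->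
  exists a b, [/\ a \in S, b \notin v |: S & adj G a b].

Lemma connect_induced (T : finType) (G : sgraph T) (U V : {set T}) (x y : T) :
  U \subset V -> connect (induced G U) x y -> connect (induced G V) x y.
Proof.
move=> /subsetP sUV; apply: connect_sub => a b /and3P[ab aU bU].
by apply/connect1/and3P; split; rewrite ?sUV.
Qed.

Lemma connect_induced_sym (T : finType) (G : sgraph T) (U : {set T}) :
  connect_sym (induced G U).
Proof. by apply: sym_connect_sym => a b; rewrite /induced adj_sym [(a \in U) && _]andbC. Qed.

(** * One blank among distinct tiles: growing a set of exchangeable positions *)

Section Star.
Variables (T : finType) (c : T) (X Y : sgraph T).
Hypothesis adjX : forall a b, adj X a b = ((a == c) != (b == c)).
Local Notation reach := (connect (adj (FS X Y))).

(** The blank [c] follows the path and displaces only tiles standing on it, hence in [U]. *)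
Lemma star_walk (U : {set T}) (s : {perm T}) (y : T) :
    connect (induced Y U) (s c) y ->
  exists t, [/\ reach s t, t c = y & forall i, s i \notin U -> t i = s i].
Proof.
move=> /connectP[l]; elim: l s => [|z l IHl] s /=.
  by move=> _ ->; exists s; split; rewrite ?connect0.
case/andP => /and3P[Ysz scU zU]; pose i := (s^-1)%g z.
have si : s i = z by rewrite permKV.
have neq_ic : i != c by apply: contraTneq Ysz => ic; rewrite -si ic adj_irr.
pose s' := (tperm c i * s)%g; have s'c : s' c = z by rewrite permM tpermL.
rewrite -s'c => /IHl IH /IH[t [s't tc tE]]; exists t; split=> //.
  apply: connect_trans s't; apply: FS_step; last by rewrite si.
  by rewrite adjX eqxx (negPf neq_ic).
move=> j sjU; have jE : tperm c i j = j.
  by rewrite tpermD //; apply: contraNneq sjU => <-; rewrite ?si.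
by rewrite tE permM jE.
Qed.

Lemma star_aut (pi : {perm T}) : pi c = c -> {mono pi : a b / adj X a b}.
Proof.
by move=> pic a b; rewrite !adjX -{1 2}pic !(inj_eq perm_inj).
Qed.

Definition swappable (s : {perm T}) (i j : T) := reach s (tperm i j * s)%g.

(** The route from [s] to [t], replayed backwards with [i] and [j] renamed, returns to [s] with
    these two exchanged. The renaming is an automorphism of the star because it fixes [c]. *)
Lemma swappable_reach (s t : {perm T}) (i j : T) :
  i != c -> j != c -> reach s t -> swappable t i j -> swappable s i j.
Proof.
move=> ic jc st tij; apply: (connect_trans st (connect_trans tij _)).
rewrite FS_reach_sym; apply: FS_reach_aut st; apply: star_aut.
exact: tpermD.
Qed.

Lemma swappable_sym (s : {perm T}) (i j : T) : swappable s i j -> swappable s j i.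
Proof. by rewrite /swappable tpermC. Qed.

Lemma swappable_trans (s : {perm T}) (i j l : T) :
    i != c -> j != c -> l != c ->
  swappable s i j -> swappable s j l -> swappable s i l.
Proof.
move=> ic jc lc sij sjl.
have [->|neq_il] := eqVneq i l; first by rewrite /swappable tperm1 mul1g connect0.
have [<-//|neq_jl] := eqVneq j l; have [->//|neq_ij] := eqVneq i j.
rewrite /swappable; have -> : tperm i l = (tperm i j * (tperm j l * tperm i j))%g.
  by rewrite -{1}(tpermV i j) -conjgE tpermJ tpermR tpermD.
have aut_ij := star_aut (tpermD ic jc).
apply: (connect_trans sij _); rewrite -!mulgA; apply: (FS_reach_aut aut_ij).
apply: connect_trans sjl _; have aut_jl := star_aut (tpermD jc lc).
exact: (FS_reach_aut aut_jl).
Qed.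

Definition swap_closed (W : {set T}) := forall (s : {perm T}) i j,
  s c \in W -> s i \in W -> s j \in W -> i != c -> j != c -> swappable s i j.

Lemma swap_closed_triangle (t1 t2 t3 : T) :
  triangle Y t1 t2 t3 -> swap_closed [set t1; t2; t3].
Proof.
case/and3P => Y12 Y13 Y23 s i j scW siW sjW ic jc.
have [->|neq_ij] := eqVneq i j; first by rewrite /swappable tperm1 mul1g connect0.
have adjW x y : x \in [set t1; t2; t3] -> y \in [set t1; t2; t3] -> x != y ->
    adj Y x y.
  rewrite !inE => /orP[/orP[]|] /eqP-> /orP[/orP[]|] /eqP->;
    by rewrite ?eqxx // adj_sym.
by apply: (FS_triangle_swap (c := c));
  rewrite ?adjX ?eqxx ?(negPf ic) ?(negPf jc) // adjW // (inj_eq perm_inj) // eq_sym.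
Qed.

(** The tiles on [W] can already be exchanged, so it is enough to exchange the tile on [x] with a
    single tile of [W]. *)
Lemma swap_closed_grow (W : {set T}) (w x a b : T) :
    swap_closed W -> (forall u v, u \in W -> v \in W -> connect (induced Y W) u v) ->
    2 < #|W| -> w \in W -> x \notin W -> adj Y w x ->
    connect (induced Y (~: W)) x a -> b \in W -> b != w -> adj Y a b ->
  swap_closed (x |: W).
Proof.
move=> closedW connW W3 wW xW Ywx xa bW neq_bw Yab.
have main (s : {perm T}) i j : s c = w -> s i = x -> s j \in W -> j != c ->
    swappable s i j.
  move=> sc si sjW jc.
  (* A third position [u] of [W], which the detour leaving through [w] and returning through [b]
     does not touch. *)
  have /card_gt0P[u] : 0 < #|W :\ w :\ b|.
    have := cardsD1 w W; rewrite wW => W3'.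
    have := cardsD1 b (W :\ w); rewrite !inE neq_bw bW /= => W3''.
    by move: W3; rewrite W3' W3''; case: #|_|.
  rewrite !inE => /and3P[neq_ub neq_uw uW].
  pose l := (s^-1)%g u; have sl : s l = u by rewrite permKV.
  have lc : l != c by apply: contraNneq neq_uw => lc; rewrite -sl lc sc.
  have ic : i != c by apply: contraNneq xW => ic; rewrite -si ic sc.
  have li : l != i by apply: contraNneq xW => li; rewrite -si -li sl.
  (* [l] and [j] are exchanged inside [W] from [s] itself, so by transitivity only [i] and [l]
     remain. *)
  have slj : swappable s l j by apply: closedW; rewrite ?sc ?sl.
  apply: swappable_trans slj => //.
  pose s1 := (tperm c i * s)%g.
  have ss1 : reach s s1.
    by apply: FS_step; rewrite ?sc ?si // adjX eqxx (negPf ic).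
  have s1c : s1 c = x by rewrite permM tpermL.
  have s1i : s1 i = w by rewrite permM tpermR.
  have s1l : s1 l = u by rewrite permM tpermD // eq_sym.
  rewrite -s1c in xa; have [s2 [s12 s2c s2E]] := star_walk xa.
  have s2i : s2 i = w by rewrite s2E ?s1i // inE negbK.
  have s2l : s2 l = u by rewrite s2E ?s1l // inE negbK.
  pose m := (s2^-1)%g b; have s2m : s2 m = b by rewrite permKV.
  have mi : m != i by apply: contraNneq neq_bw => mi; rewrite -s2m mi s2i.
  have ml : m != l by apply: contraNneq neq_ub => ml; rewrite -s2m ml s2l.
  have mc : m != c by apply: contraTneq Yab => mc; rewrite -s2m mc s2c adj_irr.
  (* The blank re-enters [W]: now [c], [i] and [l] stand on [b], [w] and [u]. *)
  pose s3 := (tperm c m * s2)%g.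
  have s23 : reach s2 s3.
    by apply: FS_step; rewrite ?s2c ?s2m // adjX eqxx (negPf mc).
  have s3s : reach s s3 := connect_trans ss1 (connect_trans s12 s23).
  apply: swappable_reach s3s _ => //; apply: closedW => //.
  - by rewrite permM tpermL s2m.
  - by rewrite permM tpermD ?s2i // eq_sym.
  - by rewrite permM tpermD ?s2l // eq_sym.
(* In general the blank first walks to [w] inside [x |: W]; tiles that started in this set stay in
   it. *)
move=> s i j scW siW sjW ic jc.
have xwU : connect (induced Y (x |: W)) x w.
  by apply: connect1; rewrite /induced adj_sym Ywx !inE eqxx wW orbT.
have scw : connect (induced Y (x |: W)) (s c) w.
  move: scW; rewrite in_setU1 => /predU1P[->//|scW].
  by apply: connect_induced (connW _ _ scW wW); apply: subsetUr.
have [t [st tc tE]] := star_walk scw.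
have tU l : s l \in x |: W -> t l \in x |: W.
  apply: contraLR => tl; pose m := (s^-1)%g (t l).
  have sm : s m = t l by rewrite permKV.
  have tm : t m = t l by rewrite tE ?sm.
  by rewrite -(perm_inj tm) sm.
apply: swappable_reach st _ => //.
have [->|neq_ij] := eqVneq i j; first by rewrite /swappable tperm1 mul1g connect0.
move: (tU i siW) (tU j sjW); rewrite !in_setU1.
case/predU1P => [ti|tiW] /predU1P[tj|tjW].
- by case/eqP: neq_ij; apply: (@perm_inj _ t); rewrite ti tj.
- exact: main.
- exact/swappable_sym/main.
- by apply: closedW; rewrite ?tc.
Qed.

End Star.

(** * Connectedness when the token graph is a star *)

Section StarConnected.
Variables (T : finType) (c : T) (X Y : sgraph T).
Hypothesis adjX : forall a b, adj X a b = ((a == c) != (b == c)).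
Variables t1 t2 t3 : T.
Hypotheses (Ytri : triangle Y t1 t2 t3) (Ycut : cut_free Y).
Local Notation reach := (connect (adj (FS X Y))).

Lemma triangle_neq : [&& t1 != t2, t1 != t3 & t2 != t3].
Proof.
case/and3P: Ytri => Y12 Y13 Y23; apply/and3P.
by split; [move: Y12|move: Y13|move: Y23]; apply: contraTneq => ->; rewrite adj_irr.
Qed.

Lemma swap_closed_card m : 2 < m <= #|T| -> exists W : {set T},
  [/\ #|W| = m, swap_closed c X Y W &
      forall u v, u \in W -> v \in W -> connect (induced Y W) u v].
Proof.
elim: m => // m IHm /andP[m3 mT]; move: m3; rewrite ltnS leq_eqVlt => /predU1P[<-|m3].
  exists [set t1; t2; t3]; split.
  - case/and3P: triangle_neq => n12 n13 n23.
    by rewrite setUC cardsU1 cards2 !inE negb_or ![t3 == _]eq_sym n13 n23 n12.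
  - exact: swap_closed_triangle.
  case/and3P: Ytri => Y12 Y13 Y23 u v; rewrite !inE => uW vW.
  have [->|neq_uv] := eqVneq u v; first exact: connect0.
  apply: connect1; rewrite /induced !inE uW vW !andbT.
  by move: uW vW neq_uv => /orP[/orP[]|] /eqP-> /orP[/orP[]|] /eqP->;
    rewrite ?eqxx // adj_sym.
have [|W [Wm closedW connW]] := IHm; first by rewrite m3 ltnW.
have [v vW] : exists v, v \in W by apply/card_gt0P; rewrite Wm; case: (m) m3.
have Wbig (S : {set T}) y : [disjoint S & W] -> y |: S != setT.
  move=> /pred0P SW; apply: contraTneq m3 => yST; rewrite -leqNgt -Wm.
  rewrite -(cards1 y) leqW // subset_leq_card //; apply/subsetP => z zW.
  have : z \in y |: S by rewrite yST inE.
  by rewrite !inE => /orP[//|zS]; have := SW z; rewrite /= zS zW.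
(* Any [v] in [W] serves as the removed vertex: the cut condition for the complement of [W] yields
   an edge into [W]. *)
have [x [w [xW wW Yxw]]] : exists x w, [/\ x \notin W, w \in W & adj Y x w].
  have [|||x [w [xW wW Yxw]]] := @Ycut v (~: W).
  - apply: contraTneq mT => /setP W0; rewrite -leqNgt -Wm subset_leq_card //.
    by apply/subsetP => z _; have := W0 z; rewrite !inE => /negbFE.
  - by rewrite inE vW.
  - by apply: Wbig; rewrite disjoints_subset.
  exists x, w; rewrite inE in xW; split=> //.
  by move: wW; rewrite !inE negb_or negbK => /andP[].
(* [S] is the component of [x] outside [W]. After removing [w] an edge still leaves it, and such an
   edge can only end in [W], at a vertex other than [w]. *)
pose S := [set z in ~: W | connect (induced Y (~: W)) x z].
have [|||a [b [aS bS Yab]]] := @Ycut w S.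
- by apply/set0Pn; exists x; rewrite !inE xW connect0.
- by rewrite !inE wW.
- apply: Wbig; apply/pred0P => z /=; rewrite !inE.
  by case: (z \in W); rewrite ?andbF.
move: aS bS; rewrite !inE !negb_or negb_and negbK => /andP[aW xa] /andP[neq_bw bW].
have {}bW : b \in W.
  case/orP: bW => //; apply: contraR => bW.
  by apply: connect_trans xa (connect1 _); rewrite /induced Yab !inE aW bW.
exists (x |: W); split.
- by rewrite cardsU1 xW Wm.
- by apply: (swap_closed_grow adjX closedW connW _ wW xW _ xa bW neq_bw Yab);
    rewrite ?Wm // adj_sym.
have conn_w u : u \in x |: W -> connect (induced Y (x |: W)) u w.
  rewrite in_setU1 => /predU1P[->|uW].
    by apply: connect1; rewrite /induced Yxw !inE eqxx wW orbT.
  by apply: connect_induced (connW _ _ uW wW); apply: subsetUr.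
move=> u u' /conn_w uw /conn_w u'w; apply: connect_trans uw _.
by rewrite connect_induced_sym.
Qed.

(** When [W] is the whole vertex set, any two tiles can be exchanged. The blank is walked to its
    target, and what remains is a permutation of tiles fixing [c]. *)
Lemma FS_star_connected (s t : {perm T}) : reach s t.
Proof.
have T3 : 2 < #|T|.
  case/and3P: triangle_neq => n12 n13 n23.
  rewrite -cardsT; apply: (leq_trans _ (subset_leq_card (subsetT [set t1; t2; t3]))).
  by rewrite setUC cardsU1 cards2 !inE negb_or ![t3 == _]eq_sym n13 n23 n12.
have [|W [WT closedW connW]] := @swap_closed_card #|T|; first by rewrite T3 leqnn.
have {WT} WT : W = setT by apply/eqP; rewrite eqEcard subsetT cardsT WT /=.
have inW z : z \in W by rewrite WT inE.
have [s' [ss' s'c _]] := star_walk adjX (connW _ _ (inW (s c)) (inW (t c))).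
apply: connect_trans ss' _; have -> : t = ((t * s'^-1) * s')%g by rewrite mulgKV.
apply: (@FS_reach_perm_on _ _ _ (~: [set c])) => [r i j|].
  by rewrite !inE => ic jc _; apply: closedW.
apply/subsetP => i; rewrite !inE; apply: contraNneq => ->.
by rewrite permM -s'c permK.
Qed.

End StarConnected.

(** * From stars to complete bipartite token graphs *)

Section Bipartite.
Variables (T : finType) (P : pred T) (X Y : sgraph T).
Hypothesis adjX : forall a b, adj X a b = (P a != P b).
Local Notation reach := (connect (adj (FS X Y))).

Definition same_class (c : T) : {set T} := [set x | P x == P c].

Lemma star_rel_irr (c : T) : irreflexive (fun a b : T => (a == c) != (b == c)).
Proof. by move=> a; rewrite eqxx. Qed.

Definition star (c : T) : sgraph T := graph_of_rel (star_rel_irr c).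

Lemma adj_star (c a b : T) : adj (star c) a b = ((a == c) != (b == c)).
Proof. by apply: adj_graph_of_rel => x y; rewrite eq_sym. Qed.

Lemma perm_on_class (c : T) (pi : {perm T}) (x : T) :
  perm_on (same_class c) pi -> P (pi x) = P x.
Proof.
move=> pi_on; have [xD|xD] := boolP (x \in same_class c).
  move: (xD); rewrite -(perm_closed x pi_on) inE => /eqP->.
  by move: xD; rewrite inE => /eqP.
by rewrite (out_perm pi_on xD).
Qed.

(* When the center [c] of the star meets a token of its own class, relabelling *)
(* that class replaces the forbidden swap.                                     *)
Lemma star_reach (c : T) (s t : {perm T}) : connect (adj (FS (star c) Y)) s t ->
  exists2 pi : {perm T}, perm_on (same_class c) pi & reach s (pi * t)%g.
Proof.
(* [pi0] records the relabelling accumulated so far along the path. *)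
suff gen (pi0 : {perm T}) : perm_on (same_class c) pi0 ->
    connect (adj (FS (star c) Y)) s t ->
    exists2 pi : {perm T}, perm_on (same_class c) pi & reach (pi0 * s)%g (pi * t)%g.
  by move=> st; have := gen 1%g (perm_on1 _) st; rewrite mul1g.
move=> pi0_on /connectP[l sl ->] {t}; elim: l s pi0 pi0_on sl => [|t l IHl] s pi0 pi0_on /=.
  by move=> _; exists pi0; rewrite ?connect0.
case/andP => /FS_adjP st /IHl{IHl} IH.
have {st} [j [jc Ycj tE]] :
    exists j, [/\ j != c, adj Y (s c) (s j) & t = (tperm c j * s)%g].
  case: st => a [b []]; rewrite adj_star.
  case: (eqVneq a c) => [->|nac]; first by case: (eqVneq b c) => // bc _; exists b.
  by case: (eqVneq b c) => // -> _; exists a; rewrite adj_sym tpermC.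
have [Pjc|Pjc] := eqVneq (P j) (P c).
  (* The swap is not performed: composing the relabelling with [tperm c j] leaves the actual
     arrangement unchanged. *)
  have [|pi pi_on reach_pi] := IH (pi0 * tperm c j)%g.
    apply: perm_onM => //; apply/subsetP => y; rewrite !inE.
    by case: tpermP => [->|->|]; rewrite ?eqxx // Pjc.
  by exists pi => //; move: reach_pi; rewrite tE -!mulgA (mulgA (tperm c j)) tperm2 mul1g.
have [pi pi_on reach_pi] := IH _ pi0_on; exists pi => //.
(* [d] is the token actually standing where the star has [c]. It belongs to the class of [c], so its
   swap with [j] is legal. *)
apply: connect_trans reach_pi; pose d := (pi0^-1)%g c.
have pi0d : pi0 d = c by rewrite permKV.
have pi0j : pi0 j = j by apply: (out_perm pi0_on); rewrite inE.
have -> : (pi0 * t = tperm d j * (pi0 * s))%g.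
  by rewrite tE -{1}pi0d -{1}pi0j -tpermJ conjgE !mulgA mulgV mul1g.
apply: FS_step; last by rewrite !permM pi0d pi0j.
by rewrite adjX -(perm_on_class _ pi0_on) pi0d eq_sym.
Qed.

(** Each transposition corrects one value and keeps those already set, because points and targets
    are distinct. *)
Lemma perm_through (x1 x2 x3 y1 y2 y3 : T) :
    [&& x1 != x2, x1 != x3 & x2 != x3] -> [&& y1 != y2, y1 != y3 & y2 != y3] ->
  exists s : {perm T}, [/\ s x1 = y1, s x2 = y2 & s x3 = y3].
Proof.
move=> /and3P[x12 x13 x23] /and3P[y12 y13 y23].
pose s1 := tperm x1 y1; pose s2 := (s1 * tperm (s1 x2) y2)%g.
pose s3 := (s2 * tperm (s2 x3) y3)%g.
have s1x1 : s1 x1 = y1 by rewrite tpermL.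
have s2x1 : s2 x1 = y1.
  by rewrite permM s1x1 tpermD // 1?eq_sym // -s1x1 (inj_eq perm_inj).
have s2x2 : s2 x2 = y2 by rewrite permM tpermL.
exists s3; split; last by rewrite permM tpermL.
  by rewrite permM s2x1 tpermD // 1?eq_sym // -s2x1 (inj_eq perm_inj).
by rewrite permM s2x2 tpermD // 1?eq_sym // -s2x2 (inj_eq perm_inj).
Qed.

Variables t1 t2 t3 : T.
Hypotheses (Ytri : triangle Y t1 t2 t3) (Ycut : cut_free Y).
Hypothesis P_split : forall x, exists c, P c != P x.

Lemma FS_bipartite_connected (s t : {perm T}) : reach s t.
Proof.
have gather c (r u : {perm T}) : exists2 pi : {perm T},
    perm_on (same_class c) pi & reach r (pi * u)%g.
  exact/star_reach/(FS_star_connected (adj_star c) Ytri Ycut).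
have swap r i j : P i = P j -> i != j -> reach r (tperm i j * r)%g.
  move=> Pij neq_ij; have [c Pci] := P_split i.
  have neq_ci : c != i by apply: contraNneq Pci => ->.
  have neq_cj : c != j by apply: contraNneq Pci => ->; rewrite Pij.
  have [|rho [rhoc rhoi rhoj]] := perm_through _ (triangle_neq Ytri) (x1 := c) (x2 := i) (x3 := j).
    by rewrite neq_ci neq_cj.
  have [pi pi_on r_rho] := gather c r rho.
  (* [pi] may permute the class of [c] but fixes [i] and [j], so [d] takes the place of [c] on the
     triangle. *)
  pose d := (pi^-1)%g c; have pid : pi d = c by rewrite permKV.
  have Pd : P d = P c by rewrite -(perm_on_class d pi_on) pid.
  have pii : pi i = i by apply: (out_perm pi_on); rewrite inE eq_sym.
  have pij : pi j = j by apply: (out_perm pi_on); rewrite inE -Pij eq_sym.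
  have tri_ij : reach (pi * rho)%g (tperm i j * (pi * rho))%g.
    case/and3P: Ytri => Y12 Y13 Y23.
    by apply: (FS_triangle_swap (c := d)); rewrite ?adjX ?Pd -?Pij // !permM
      ?pid ?pii ?pij ?rhoc ?rhoi ?rhoj.
  (* The route to the triangle is retraced with [i] and [j] renamed, which is an automorphism as
     they share a class. *)
  apply: connect_trans (connect_trans r_rho tri_ij) _.
  rewrite FS_reach_sym; apply: FS_reach_aut r_rho => a b; rewrite !adjX.
  by congr (_ != _); case: tpermP => [->|->|].
(* Here [t1] is read as a token; any center would do. *)
have [pi pi_on s_t] := gather t1 s t; apply: connect_trans s_t _.
rewrite FS_reach_sym; apply: (FS_reach_perm_on _ _ pi_on) => r i j.
by rewrite !inE => /eqP Pi /eqP Pj; apply: swap; rewrite Pi Pj.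
Qed.
End Bipartite.

(** * Deterministic criteria for connectedness and disconnectedness *)

Lemma gconnected_FS_Kbip (k n : nat) (Y : sgraph 'I_n) (t1 t2 t3 : 'I_n) :
    0 < k < n -> triangle Y t1 t2 t3 -> cut_free Y ->
  gconnected (FS (Kbip k n) Y).
Proof.
case/andP => k0 kn Ytri Ycut; apply/forallP => s; apply/forallP => t.
apply: (FS_bipartite_connected (P := fun x : 'I_n => x < k)) Ytri Ycut _ s t.
  exact: adj_Kbip.
move=> x; have [xk|xk] := ltnP x k.
  by exists (Ordinal kn); rewrite ltnn.
by exists (Ordinal (leq_trans k0 (ltnW kn))); rewrite /= k0.
Qed.

Lemma isolated_FS_disconnected (T : finType) (X Y : sgraph T) (v : T) :
  1 < #|T| -> (forall u, ~~ adj Y v u) -> ~~ gconnected (FS X Y).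
Proof.
move=> T2 isoY; have /existsP[u neq_uv] : [exists u, u != v].
  rewrite -negb_forall; apply: contraL T2 => /forallP eq_v; rewrite -leqNgt.
  by apply/card_le1P => x _ y; rewrite (eqP (eq_v x)) inE; have := eq_v y; rewrite inE.
have stuck (s t : {perm T}) : connect (adj (FS X Y)) s t -> s v = v -> t v = v.
  move=> /connectP[l sl ->] {t}; elim: l s sl => //= t l IHl s.
  case/andP => /FS_adjP[a [b [_ Yab ->]]] /IHl tl sv; apply: tl.
  rewrite permM tpermD //.
    by apply: contraTneq Yab => ->; rewrite sv (negPf (isoY _)).
  by apply: contraTneq Yab => ->; rewrite sv adj_sym (negPf (isoY _)).
apply: contraNN neq_uv => /forallP/(_ 1%g)/forallP/(_ (tperm v u)).
by move/stuck; rewrite perm1 tpermL => ->.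
Qed.

(** * Events of the random graph *)

Section Patterns.
Local Open Scope ring_scope.
Import GRing.Theory Order.TTheory Num.Theory.

(** Expanding the product gives a sum over sets of pairs. Sets that are not pairs get the weights 0
    and 1, which discards every family containing one. *)
Lemma sum_sgraph_prod (R : comNzRingType) (n : nat) (f g : {set 'I_n} -> R) :
  \sum_(G : sgraph 'I_n) \prod_(e in vpairs 'I_n)
      (if e \in edges G then f e else g e) =
  \prod_(e in vpairs 'I_n) (f e + g e).
Proof.
pose F e := if e \in vpairs 'I_n then f e else 0.
pose H e := if e \in vpairs 'I_n then g e else 1.
transitivity (\prod_e (F e + H e)); last first.
  by rewrite [RHS]big_mkcond; apply: eq_bigr => e _; rewrite /F /H; case: ifP; rewrite ?add0r.
have -> : \prod_e (F e + H e) =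
    \sum_(E : {set {set 'I_n}}) \prod_e (if e \in E then F e else H e).
  exact: bigA_distr.
rewrite [RHS](bigID (fun E : {set {set 'I_n}} => E \subset vpairs 'I_n)) /=.
rewrite [X in _ = _ + X]big1 ?addr0 => [|E /subsetPn[e eE /negPf eP]]; last first.
  by rewrite (bigD1 e) //= eE /F eP mul0r.
rewrite [RHS](reindex_omap (@edges 'I_n) insub) /=; last first.
  by move=> E sE; rewrite insubT.
apply: eq_big => [G|G _]; first by rewrite (edges_sub G) /= valK eqxx.
rewrite big_mkcond; apply: eq_bigr => e _; rewrite /F /H.
case: ifP => // /negP eP; case: ifP => // eG.
by case: eP; apply: (subsetP (edges_sub G)).
Qed.

Definition pattern (n : nat) (A B : {set {set 'I_n}}) : pred (sgraph 'I_n) :=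
  fun G => (A \subset edges G) && [disjoint B & edges G].

(** Weight 0 on the absence of a pair of [A] and on the presence of a pair of [B] restricts the sum
    to the pattern. Every other pair contributes [p + (1 - p) = 1]. *)
Lemma gnp_prob_pattern (R : comNzRingType) (n : nat) (p : R) (A B : {set {set 'I_n}}) :
    A \subset vpairs 'I_n -> B \subset vpairs 'I_n -> [disjoint A & B] ->
  gnp_prob p (pattern A B) = p ^+ #|A| * (1 - p) ^+ #|B|.
Proof.
move=> sA sB dAB; pose f e := if e \in B then 0 else p.
pose g e := if e \in A then 0 else 1 - p.
transitivity (\prod_(e in vpairs 'I_n) (f e + g e)).
  rewrite -sum_sgraph_prod /gnp_prob big_mkcond; apply: eq_bigr => G _.
  case: ifPn => [/andP[/subsetP AG /pred0P BG]|].
    apply: eq_bigr => e _; rewrite /f /g; have := BG e; rewrite /=.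
    case: ifPn => eG; first by rewrite andbT => ->.
    by move=> _; rewrite ifN //; apply: contraNN eG; apply: AG.
  rewrite negb_and => /orP[/subsetPn[e eA eG]|/pred0Pn[e /andP[eB eG]]].
    by rewrite (bigD1 e) ?(subsetP sA) //= (negPf eG) /g eA mul0r.
  have {}eB : e \in B by []; have {}eG : e \in edges G by [].
  by rewrite (bigD1 e) ?(subsetP sB) //= eG /f eB mul0r.
rewrite -!prodr_const [X in X * _]big_mkcond [X in _ * X]big_mkcond -big_split.
rewrite big_mkcond; apply: eq_bigr => e _; rewrite /f /g /=.
have := pred0P dAB e; have := subsetP sA e; have := subsetP sB e; rewrite /=.
case: (e \in A); case: (e \in B) => // sBe sAe _.
- by rewrite sAe // addr0 mulr1.
- by rewrite sBe // add0r mul1r.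
by rewrite mulr1 [p + _]addrC subrK if_same.
Qed.

Variables (R : realFieldType) (n : nat) (p : R).
Hypothesis p01 : 0 <= p <= 1.
Implicit Types A B : pred (sgraph 'I_n).

Lemma gnp_weight_ge0 (G : sgraph 'I_n) : 0 <= gnp_weight p G.
Proof.
case/andP: p01 => p0 p1; apply: prodr_ge0 => e _.
by case: ifP; rewrite ?subr_ge0.
Qed.

Lemma gnp_probE A : gnp_prob p A = \sum_G gnp_weight p G * (A G)%:R.
Proof.
by rewrite /gnp_prob big_mkcond; apply: eq_bigr => G _; case: (A G); rewrite ?mulr1 ?mulr0.
Qed.

Lemma gnp_probC A : gnp_prob p (fun G => ~~ A G) = 1 - gnp_prob p A.
Proof.
by rewrite -(gnp_prob_total n p) /gnp_prob [in RHS](bigID A) /= addrAC subrr add0r.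
Qed.

Lemma gnp_prob_le A B : (forall G, A G -> B G) -> gnp_prob p A <= gnp_prob p B.
Proof.
move=> AB; rewrite !gnp_probE; apply: ler_sum => G _.
apply: ler_wpM2l; first exact: gnp_weight_ge0.
by rewrite ler_nat; case: (A G) (AB G) => // ->.
Qed.

Lemma gnp_prob_le1 A : gnp_prob p A <= 1.
Proof. by rewrite -(gnp_prob_total n p); apply: gnp_prob_le. Qed.

Lemma gnp_prob_bigU (I : finType) (Q : pred I) (E : I -> pred (sgraph 'I_n)) A :
    (forall G, A G -> exists2 i, Q i & E i G) ->
  gnp_prob p A <= \sum_(i | Q i) gnp_prob p (E i).
Proof.
move=> AE; rewrite gnp_probE (eq_bigr _ (fun i _ => gnp_probE (E i))).
rewrite exchange_big /=; apply: ler_sum => G _; rewrite -mulr_sumr.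
apply: ler_wpM2l; first exact: gnp_weight_ge0.
rewrite -natr_sum ler_nat; case AG: (A G) => //.
by have [i Qi Ei] := AE _ AG; rewrite (bigD1 i) //= Ei.
Qed.

Lemma gnp_prob_U A B C : (forall G, A G -> B G || C G) ->
  gnp_prob p A <= gnp_prob p B + gnp_prob p C.
Proof.
move=> AE; rewrite !gnp_probE -big_split; apply: ler_sum => G _ /=.
rewrite -mulrDr; apply: ler_wpM2l; first exact: gnp_weight_ge0.
by rewrite -natrD ler_nat; case: (A G) (AE G) => // /(_ isT); case: (B G); case: (C G).
Qed.

(* Chebyshev's inequality for the number of the events [E i], [i] in [Q], that hold. *)
Lemma gnp_second_moment (I : finType) (Q : pred I) (E : I -> pred (sgraph 'I_n)) (mu : R) :
    mu = \sum_(i | Q i) gnp_prob p (E i) -> 0 < mu ->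
  gnp_prob p (fun G => ~~ [exists i, Q i && E i G]) <=
    (\sum_(i | Q i) \sum_(j | Q j) gnp_prob p (fun G => E i G && E j G)) / mu ^+ 2 - 1.
Proof.
move=> muE mu0; pose N G : R := \sum_(i | Q i) (E i G)%:R.
have EN : \sum_G gnp_weight p G * N G = mu.
  rewrite muE (eq_bigr _ (fun i _ => gnp_probE (E i))) exchange_big /=.
  by apply: eq_bigr => G _; rewrite mulr_sumr.
have EN2 : \sum_G gnp_weight p G * N G ^+ 2 =
    \sum_(i | Q i) \sum_(j | Q j) gnp_prob p (fun G => E i G && E j G).
  under [RHS]eq_bigr => i _.
    under eq_bigr => j _ do rewrite gnp_probE.
    rewrite exchange_big /=; over.
  rewrite exchange_big /=; apply: eq_bigr => G _.
  rewrite expr2 {1}/N mulr_suml mulr_sumr; apply: eq_bigr => i _.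
  by rewrite !mulr_sumr; apply: eq_bigr => j _; rewrite -natrM mulnb.
rewrite -EN2 lerBrDr ler_pdivlMr ?exprn_gt0 //.
set q := gnp_prob p _.
(* On this event the count [N] vanishes, so its squared deviation is [mu ^+ 2]. *)
have : q * mu ^+ 2 <= \sum_G gnp_weight p G * (N G - mu) ^+ 2.
  rewrite /q gnp_probE mulr_suml; apply: ler_sum => G _; rewrite -mulrA.
  apply: ler_wpM2l; first exact: gnp_weight_ge0.
  case: existsP => [_|nE]; first by rewrite mul0r sqr_ge0.
  rewrite mul1r /N big1 ?sub0r ?sqrrN // => i Qi.
  by case Ei: (E i G) => //; case: nE; exists i; rewrite Qi.
have -> : \sum_G gnp_weight p G * (N G - mu) ^+ 2 =
    \sum_G gnp_weight p G * N G ^+ 2 - mu ^+ 2.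
  transitivity (\sum_G (gnp_weight p G * N G ^+ 2 - (gnp_weight p G * N G) * (mu *+ 2)
       + gnp_weight p G * mu ^+ 2)).
    by apply: eq_bigr => G _; ring.
  rewrite big_split sumrB /= -!mulr_suml EN.
  have -> : \sum_G gnp_weight p G = 1 := gnp_prob_total n p.
  by ring.
by rewrite mulrDl mul1r lerBrDr.
Qed.

End Patterns.

Lemma patternI (n : nat) (A A' B B' : {set {set 'I_n}}) (G : sgraph 'I_n) :
  pattern A B G && pattern A' B' G = pattern (A :|: A') (B :|: B') G.
Proof.
by rewrite /pattern subUset -!setI_eq0 setIUl setU_eq0 andbACA.
Qed.

(** * Existence of an isolated vertex *)

Section IsolatedVertices.
Local Open Scope ring_scope.
Import GRing.Theory Order.TTheory Num.Theory.

Definition incident (n : nat) (v : 'I_n) : {set {set 'I_n}} :=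
  [set e in vpairs 'I_n | v \in e].

Lemma incident_sub (n : nat) (v : 'I_n) : incident v \subset vpairs 'I_n.
Proof. by apply/subsetP => e; rewrite inE => /andP[]. Qed.

Lemma incidentE (n : nat) (v : 'I_n) : incident v = [set [set v; u] | u in [set~ v]].
Proof.
apply/setP => e; apply/idP/imsetP => [|[u]]; last first.
  by rewrite !inE => neq_uv ->; rewrite cards2 (eq_sym v u) neq_uv set21.
rewrite inE => /andP[]; rewrite inE => /cards2P[x [y [neq_xy ->]]].
rewrite in_set2 => /orP[]/eqP->; first by exists y; rewrite // !inE eq_sym.
by exists x; rewrite ?inE // setUC.
Qed.

Lemma card_incident (n : nat) (v : 'I_n) : #|incident v| = n.-1.
Proof.
rewrite incidentE card_in_imset; first by rewrite cardsC1 card_ord.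
move=> x y; rewrite !inE => xv yv /setP/(_ x); rewrite !inE eqxx orbT (negPf xv).
by move/esym/eqP.
Qed.

Lemma card_incidentU (n : nat) (v w : 'I_n) : v != w ->
  #|incident v :|: incident w| = (n.-1 + n.-1 - 1)%N.
Proof.
move=> neq_vw; rewrite cardsU !card_incident.
suff -> : incident v :&: incident w = [set [set v; w]] by rewrite cards1.
apply/setP => e; rewrite in_set1 incidentE [incident w]incidentE inE.
apply/andP/eqP => [[/imsetP[x xv ->] /imsetP[y yw]]|->]; last first.
  split; apply/imsetP; first by exists w; rewrite // !inE eq_sym.
  by exists v; rewrite ?inE // setUC.
by move=> /setP/(_ w); rewrite !inE eqxx eq_sym (negPf neq_vw) /= => /eqP ->.
Qed.

(** Two distinct vertices share one incident pair, so both are isolated with the product probability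
    divided by [1 - p]. This excess gives [p / (1 - p)]; the diagonal gives the inverse of the
    expected number. *)
Lemma gnp_no_isolated (R : realFieldType) (n : nat) (p : R) : (1 < n)%N -> 0 <= p < 1 ->
  gnp_prob p (fun G : sgraph 'I_n => ~~ [exists v, forall u, ~~ adj G v u]) <=
    (n%:R * (1 - p) ^+ n.-1)^-1 + p / (1 - p).
Proof.
move=> n1 /andP[p0 p1]; set r := 1 - p; have r0 : 0 < r by rewrite subr_gt0.
have p01 : 0 <= p <= 1 by rewrite p0 ltW.
have P1 (B : {set {set 'I_n}}) : B \subset vpairs 'I_n ->
    gnp_prob p (pattern set0 B) = r ^+ #|B|.
  by move=> sB; rewrite gnp_prob_pattern ?sub0set ?cards0 ?mul1r // -setI_eq0 set0I.
set mu := n%:R * r ^+ n.-1.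
have mu0 : 0 < mu by rewrite mulr_gt0 ?exprn_gt0 // ltr0n ltnW.
pose E (v : 'I_n) := pattern set0 (incident v).
have muE : mu = \sum_(v | predT v) gnp_prob p (E v).
  under eq_bigr => v _ do rewrite P1 ?incident_sub // card_incident.
  by rewrite sumr_const card_ord -mulr_natl.
have n0 : n%:R != 0 :> R by rewrite pnatr_eq0 -lt0n ltnW.
have rX : r ^+ (n.-1 + n.-1 - 1) = (r ^+ n.-1) ^+ 2 / r.
  apply: (canRL (mulfK _)); first by rewrite gt_eqF.
  by rewrite -exprSr -exprM; congr (r ^+ _); case: (n) n1 => [|[|m]] //= _; lia.
have -> : mu^-1 + p / r = (mu + n%:R ^+ 2 * r ^+ (n.-1 + n.-1 - 1)) / mu ^+ 2 - 1.
  have X0 : r ^+ n.-1 != 0 by rewrite gt_eqF ?exprn_gt0.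
  have pE : p = 1 - r by rewrite /r opprB addrC subrK.
  rewrite rX pE /mu; move: (r ^+ n.-1) X0 => X X0.
  by field; rewrite X0 n0 gt_eqF.
apply: le_trans (le_trans (gnp_second_moment p01 muE mu0) _).
  apply: gnp_prob_le => // G; apply: contraNN => /existsP[v /andP[_ /andP[_ Ev]]].
  apply/existsP; exists v; apply/forallP => u; apply/negP => vu.
  have neq_vu : v != u by apply: contraTneq vu => ->; rewrite adj_irr.
  have /pred0P/(_ [set v; u]) := Ev; rewrite /= -[_ \in edges G]/(adj G v u) vu andbT.
  by rewrite !inE cards2 neq_vu eqxx.
rewrite lerB // ler_pM2r ?invr_gt0 ?exprn_gt0 //.
have -> : mu + n%:R ^+ 2 * r ^+ (n.-1 + n.-1 - 1) =
    \sum_(v : 'I_n) (r ^+ n.-1 + n%:R * r ^+ (n.-1 + n.-1 - 1)).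
  by rewrite sumr_const card_ord -mulr_natl /mu; ring.
apply: ler_sum => v _; rewrite (bigD1 v) //=; apply: lerD.
  apply: le_trans (gnp_prob_le p01 (B := E v) _) _; first by move=> G /andP[].
  by rewrite P1 ?incident_sub // card_incident.
have pair_le w : w != v ->
    gnp_prob p (fun G => E v G && E w G) <= r ^+ (n.-1 + n.-1 - 1).
  move=> neq_wv.
  apply: le_trans (gnp_prob_le p01 (B := pattern set0 (incident v :|: incident w)) _) _.
    by move=> G; rewrite patternI setU0.
  by rewrite P1 ?card_incidentU // 1?eq_sym // subUset !incident_sub.
apply: le_trans (ler_sum _ pair_le) _; rewrite sumr_const -(mulr_natl (r ^+ _)).
apply: ler_wpM2r; first by rewrite exprn_ge0 // ltW.
by rewrite ler_nat (leq_trans (max_card _)) ?card_ord.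
Qed.
End IsolatedVertices.

(** * Existence of a triangle *)

Section Triangles.
Local Open Scope ring_scope.
Import GRing.Theory Order.TTheory Num.Theory.

Definition pairs_in (n : nat) (t : {set 'I_n}) : {set {set 'I_n}} :=
  [set e : {set 'I_n} | e \subset t & #|e| == 2%N].

Lemma pairs_in_sub (n : nat) (t : {set 'I_n}) : pairs_in t \subset vpairs 'I_n.
Proof. by apply/subsetP => e; rewrite !inE => /andP[]. Qed.

Lemma card_pairs_in (n : nat) (t : {set 'I_n}) : #|pairs_in t| = 'C(#|t|, 2).
Proof. exact: cards_draws. Qed.

Lemma card_pairs_inU (n : nat) (t u : {set 'I_n}) :
    #|t| = 3%N -> #|u| = 3%N ->
  #|pairs_in t :|: pairs_in u| = (6 - 'C(#|t :&: u|, 2))%N.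
Proof.
move=> t3 u3; rewrite cardsU !card_pairs_in t3 u3 -card_pairs_in.
congr (_ - #|pred_of_set _|)%N; apply/setP => e; rewrite !inE subsetI.
by case: (#|e| == 2%N); rewrite ?andbT ?andbF.
Qed.

Lemma triangle_pairs_in (n : nat) (G : sgraph 'I_n) (t : {set 'I_n}) :
    #|t| = 3%N -> pairs_in t \subset edges G ->
  exists x y z, triangle G x y z.
Proof.
move=> t3 /subsetP tG; have adjt x y : x \in t -> y \in t -> x != y -> adj G x y.
  by move=> xt yt neq_xy; apply: tG; rewrite inE subUset !sub1set xt yt cards2 neq_xy.
have [x xt] : exists x, x \in t by apply/card_gt0P; rewrite t3.
have : #|t :\ x| == 2%N by have := cardsD1 x t; rewrite t3 xt add1n => -[] <-.
case/cards2P => y [z [yz txE]].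
have /setD1P[yx yt] : y \in t :\ x by rewrite txE set21.
have /setD1P[zx zt] : z \in t :\ x by rewrite txE set22.
by exists x, y, z; rewrite /triangle !adjt // eq_sym.
Qed.

(** Two such triples are encoded by their two common vertices and the third vertex of each. *)
Lemma card_two_common (n : nat) :
  (#|[set tu : {set 'I_n} * {set 'I_n} |
      [&& #|tu.1| == 3%N, #|tu.2| == 3%N & #|tu.1 :&: tu.2| == 2%N]]| <= n ^ 4)%N.
Proof.
pose f (q : 'I_n * 'I_n * ('I_n * 'I_n)) :=
  ([set q.1.1; q.1.2; q.2.1], [set q.1.1; q.1.2; q.2.2]).
have <- : #|[set: 'I_n * 'I_n * ('I_n * 'I_n)]| = (n ^ 4)%N.
  by rewrite cardsT !card_prod card_ord !expnS expn0 muln1 !mulnA.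
apply: leq_trans (leq_imset_card f _); apply/subset_leq_card/subsetP => -[t u].
rewrite inE /= => /and3P[/eqP t3 /eqP u3 /cards2P[a [b [neq_ab tuE]]]].
have third (v : {set 'I_n}) : #|v| = 3%N -> t :&: u \subset v ->
    exists c, v = [set a; b; c].
  move=> v3 tuv; have : #|v :\: (t :&: u)| == 1%N.
    by rewrite cardsD (setIidPr tuv) v3 tuE cards2 neq_ab.
  case/cards1P => c vc; exists c; rewrite -tuE -vc.
  by rewrite -{1}(setID v (t :&: u)) (setIidPr tuv).
have [c tE] := third t t3 (subsetIl _ _); have [d uE] := third u u3 (subsetIr _ _).
by apply/imsetP; exists (a, b, (c, d)); rewrite /f /= ?inE // -tE -uE.
Qed.

(** The factor 4 beyond [3!] absorbs the lower order terms; the bound fails at [n = 3]. *)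
Lemma leq_cube_bin (n : nat) : (3 < n -> n ^ 3 <= 24 * 'C(n, 3))%N.
Proof.
case: n => [|[|[|[|m]]]] //= _; have := bin_ffact m.+4 3.
by rewrite !factS !ffactnS ffactn0 fact0 /=; nia.
Qed.

(** Second moment over triples of vertices: the first error term comes from triples sharing two
    vertices, with [576 = 24 ^ 2], the second from the diagonal. *)
Lemma gnp_no_triangle (R : realFieldType) (n : nat) (p : R) :
    (3 < n)%N -> 0 < p <= 1 ->
  gnp_prob p (fun G : sgraph 'I_n => ~~ [exists x, exists y, exists z, triangle G x y z])
    <= 576%:R / (n%:R ^+ 2 * p) + 24%:R / (n%:R * p) ^+ 3.
Proof.
move=> n3 /andP[p0 p1]; have p01 : 0 <= p <= 1 by rewrite p1 ltW.
have P1 (A : {set {set 'I_n}}) : A \subset vpairs 'I_n ->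
    gnp_prob p (pattern A set0) = p ^+ #|A|.
  move=> sA; rewrite gnp_prob_pattern ?sub0set ?cards0 ?mulr1 //.
  by rewrite -setI_eq0 setI0.
pose Q : pred {set 'I_n} := fun t => #|t| == 3%N.
pose E (t : {set 'I_n}) := pattern (pairs_in t) set0.
pose N : R := 'C(n, 3)%:R.
have cardQ : #|[set t : {set 'I_n} | Q t]| = 'C(n, 3).
  rewrite -[n in 'C(n, _)](card_ord n) -cardsT -cards_draws; apply: eq_card => t.
  by rewrite !inE subsetT.
have sumQ (x : R) : \sum_(t | Q t) x = N * x.
  by rewrite sumr_const -cardsE cardQ mulr_natl.
have N0 : n%:R ^+ 3 <= 24%:R * N.
  by rewrite /N -natrX -natrM ler_nat leq_cube_bin.
have n0 : 0 < n%:R :> R by rewrite ltr0n; apply: leq_trans n3.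
have Npos : 0 < N by have := exprn_gt0 3 n0; lra.
set mu := N * p ^+ 3.
have mu0 : 0 < mu by rewrite mulr_gt0 ?exprn_gt0.
have muE : mu = \sum_(t | Q t) gnp_prob p (E t).
  rewrite /mu -sumQ; apply: eq_bigr => t /eqP t3.
  by rewrite P1 ?pairs_in_sub // card_pairs_in t3.
apply: le_trans (le_trans (gnp_second_moment p01 muE mu0) _).
  apply: gnp_prob_le => // G; apply: contraNN => /existsP[t /andP[/eqP t3 /andP[tG _]]].
  have [x [y [z xyz]]] := triangle_pairs_in t3 tG.
  by apply/existsP; exists x; apply/existsP; exists y; apply/existsP; exists z.
(* Triples sharing at most one vertex span six pairs, those sharing two span five, and equal ones
   span three. *)
have pair_le t u : Q t -> Q u -> gnp_prob p (fun G => E t G && E u G) <=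
    p ^+ 6 + (if #|t :&: u| == 2%N then p ^+ 5 else 0) + (if t == u then p ^+ 3 else 0).
  move=> /eqP t3 /eqP u3.
  apply: le_trans (gnp_prob_le p01 (B := pattern (pairs_in t :|: pairs_in u) set0) _) _.
    by move=> G; rewrite patternI setU0.
  rewrite P1 ?subUset ?pairs_in_sub // card_pairs_inU //.
  have q i : 0 <= p ^+ i by rewrite exprn_ge0 // ltW.
  have [<-|neq_tu] := eqVneq t u.
    by rewrite setIid t3 /= addr0 lerDr.
  rewrite addr0; have : (#|t :&: u| < 3)%N.
    rewrite -t3 proper_card // properEneq subsetIl andbT.
    apply: contraNneq neq_tu => tuE; rewrite eqEcard t3 u3 leqnn andbT.
    by rewrite -tuE subsetIr.
  by case: #|_| => [|[|[|]]] //= _; rewrite ?addr0 ?lexx // lerDr.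
have sum_le : \sum_(t | Q t) \sum_(u | Q u) gnp_prob p (fun G => E t G && E u G) <=
    N ^+ 2 * p ^+ 6 + n%:R ^+ 4 * p ^+ 5 + N * p ^+ 3.
  apply: le_trans (ler_sum _ (fun t Qt => ler_sum _ (fun u Qu => pair_le t u Qt Qu))) _.
  under eq_bigr => t Qt do rewrite !big_split /=.
  rewrite !big_split /=; apply: lerD; first apply: lerD.
  - by rewrite !sumQ expr2 mulrA.
  - rewrite pair_big_dep /= -big_mkcondr /= sumr_const -(mulr_natl (p ^+ 5)).
    apply: ler_wpM2r; first by rewrite exprn_ge0 // ltW.
    rewrite -natrX ler_nat; apply: leq_trans (card_two_common n).
    by apply/subset_leq_card/subsetP => -[t u]; rewrite !inE /= andbA.
  rewrite -sumQ; apply: ler_sum => t Qt; rewrite -big_mkcondr /=.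
  by rewrite (big_pred1 t) // => u; rewrite eq_sym /=; case: eqVneq => [->|]; rewrite ?andbF // Qt.
have mu2 : 0 < mu ^+ 2 by rewrite exprn_gt0.
apply: (@le_trans _ _ (n%:R ^+ 4 / (N ^+ 2 * p) + (N * p ^+ 3)^-1)).
  rewrite lerBlDr; apply: le_trans (ler_wpM2r _ sum_le) _; first by rewrite invr_ge0 ltW.
  rewrite le_eqVlt; apply/orP; left; apply/eqP; rewrite /mu.
  by field; rewrite !gt_eqF.
have iN : N^-1 <= 24%:R / n%:R ^+ 3.
  by rewrite ler_pdivlMr ?exprn_gt0 // mulrC ler_pdivrMr.
have iN0 : 0 <= N^-1 by rewrite invr_ge0 ltW.
apply: lerD.
  have -> : 576%:R / (n%:R ^+ 2 * p) = n%:R ^+ 4 / p * (24%:R / n%:R ^+ 3) ^+ 2.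
    by field; rewrite !gt_eqF.
  have -> : n%:R ^+ 4 / (N ^+ 2 * p) = n%:R ^+ 4 / p * N^-1 ^+ 2.
    by field; rewrite !gt_eqF.
  apply: ler_wpM2l; first by rewrite divr_ge0 ?exprn_ge0 // ltW.
  by rewrite lerXn2r // nnegrE (le_trans iN0).
have -> : 24%:R / (n%:R * p) ^+ 3 = 24%:R / n%:R ^+ 3 / p ^+ 3.
  by field; rewrite !gt_eqF.
by rewrite invfM ler_wpM2r // invr_ge0 exprn_ge0 // ltW.
Qed.
End Triangles.

(** * Union bound over vertex cuts *)

Section Cuts.
Local Open Scope ring_scope.
Import GRing.Theory Order.TTheory Num.Theory.

Definition cross (n : nat) (S U : {set 'I_n}) : {set {set 'I_n}} :=
  [set [set q.1; q.2] | q in setX S U].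

Lemma cross_sub (n : nat) (S U : {set 'I_n}) : [disjoint S & U] ->
  cross S U \subset vpairs 'I_n.
Proof.
move=> SU; apply/subsetP => _ /imsetP[[a b] /setXP[/= aS bU] ->].
rewrite inE cards2 (_ : a != b) //.
by apply: contraTneq aS => ->; rewrite (disjointFl SU bU).
Qed.

Lemma card_cross (n : nat) (S U : {set 'I_n}) : [disjoint S & U] ->
  #|cross S U| = (#|S| * #|U|)%N.
Proof.
move=> SU; rewrite card_in_imset ?cardsX //.
move=> [a b] [a' b'] /setXP[/= aS bU] /setXP[/= a'S b'U] eq_e.
have neq x y : x \in S -> y \in U -> x == y = false.
  by move=> xS yU; apply: contraTF xS => /eqP->; rewrite (disjointFl SU yU).
have /set2P[->|ab'] : a \in [set a'; b'] by rewrite -eq_e set21.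
  have /set2P[ba'|->//] : b \in [set a'; b'] by rewrite -eq_e set22.
  by have := neq _ _ a'S bU; rewrite ba' eqxx.
by have := neq _ _ aS b'U; rewrite ab' eqxx.
Qed.

Lemma pattern_cross (n : nat) (S U : {set 'I_n}) (A : {set {set 'I_n}}) (G : sgraph 'I_n) :
    A \subset edges G -> (forall a b, a \in S -> b \in U -> ~~ adj G a b) ->
  pattern A (cross S U) G.
Proof.
move=> AG SU; rewrite /pattern AG; apply/pred0P => e /=; apply/negP => /andP[].
by case/imsetP => -[a b] /setXP[/= aS bU] -> abG; case/negP: (SU a b aS bU).
Qed.

Definition cut_freeb (n : nat) (G : sgraph 'I_n) : bool :=
  [forall v, forall S : {set 'I_n}, [&& S != set0, v \notin S & v |: S != setT] ==>
     [exists a, exists b, [&& a \in S, b \notin v |: S & adj G a b]]].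

Lemma cut_freebP (n : nat) (G : sgraph 'I_n) : cut_freeb G -> cut_free G.
Proof.
move=> /forallP cutG v S S0 vS vST; have := forallP (cutG v) S.
rewrite S0 vS vST => /existsP[a /existsP[b /and3P[aS bS Gab]]].
by exists a, b.
Qed.

(* Of the two sides of the cut, the smaller one is taken. *)
Lemma cut_freebPn (n : nat) (G : sgraph 'I_n) : ~~ cut_freeb G ->
  exists v, exists S : {set 'I_n}, [/\ v \notin S, (0 < #|S|)%N, (#|S|.*2 < n)%N &
    forall a b, a \in S -> b \in ~: (v |: S) -> ~~ adj G a b].
Proof.
rewrite negb_forall => /existsP[v]; rewrite negb_forall => /existsP[S].
rewrite negb_imply => /andP[/and3P[S0 vS vST] /existsPn noedge].
have SG a b : a \in S -> b \in ~: (v |: S) -> ~~ adj G a b.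
  move=> aS; rewrite inE => bS; have := existsPn (noedge a) b.
  by rewrite aS bS.
have cardT : (#|S| + #|~: (v |: S)| < n)%N.
  by rewrite -[X in (_ < X)%N]card_ord -(cardsC (v |: S)) cardsU1 vS.
have [le_SS|/ltnW le_SS] := leqP #|S| #|~: (v |: S)|; [exists v, S | exists v, (~: (v |: S))].
  by split; rewrite ?card_gt0 // -addnn (leq_ltn_trans _ cardT) // leq_add2l.
split.
- by rewrite !inE eqxx.
- by rewrite card_gt0; apply: contraNneq vST => vS0; rewrite -[v |: S]setCK vS0 setC0.
- by rewrite -addnn (leq_ltn_trans _ cardT) // leq_add2r.
move=> a b aS; rewrite !inE negb_or negbK => /andP[bv].
rewrite (negPf bv) /= => bS.
by rewrite adj_sym SG.
Qed.

(** Either no edge leaves [S], or the cut vertex [v] has a neighbour in [S]. Asking for that edge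
    costs a factor [p], so choosing [v] and the neighbour costs [s n p]; the plain factor [n] for
    [v] would be too large near the threshold, already at [s = 1]. *)
Lemma gnp_cut (R : realFieldType) (n : nat) (p : R) : 0 <= p <= 1 ->
  gnp_prob p (fun G : sgraph 'I_n => ~~ cut_freeb G) <=
    \sum_(s < n.+1 | (0 < s)%N && (s.*2 < n)%N)
       'C(n, s)%:R * ((1 - p) ^+ (s * (n.-1 - s)) * (1 + s%:R * n%:R * p)).
Proof.
move=> p01; have /andP[p0 p1] := p01; set r := 1 - p.
have r0 : 0 <= r by rewrite subr_ge0.
have r1 : r <= 1 by rewrite lerBlDr lerDl.
pose Q (S : {set 'I_n}) := (0 < #|S|)%N && (#|S|.*2 < n)%N.
pose D (S : {set 'I_n}) := pattern set0 (cross S (~: S)).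
pose F (S : {set 'I_n}) (q : 'I_n * 'I_n) :=
  pattern [set [set q.1; q.2]] (cross S (~: (q.2 |: S))).
have bad G : ~~ cut_freeb G ->
    exists2 S, Q S & D S G || [exists q, (q \in setX S (~: S)) && F S q G].
  move=> /cut_freebPn[v [S [vS S0 Sn SG]]]; exists S; first exact/andP.
  have [/existsP[x /andP[xS vx]]|/existsPn nadj] := boolP [exists x, (x \in S) && adj G x v].
    apply/orP; right; apply/existsP; exists (x, v); rewrite !inE /= xS vS /=.
    by apply: pattern_cross; rewrite ?sub1set.
  apply/orP; left; apply: pattern_cross; rewrite ?sub0set // => a b aS bS.
  have [->|neq_bv] := eqVneq b v; first by have := nadj a; rewrite aS.
  by apply: SG; rewrite // !inE negb_or neq_bv; rewrite inE in bS.
apply: le_trans (gnp_prob_bigU p01 bad) _.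
pose f s : R := r ^+ (s * (n.-1 - s)) * (1 + s%:R * n%:R * p).
have term S : Q S -> gnp_prob p
    (fun G => D S G || [exists q, (q \in setX S (~: S)) && F S q G]) <= f #|S|.
  move=> /andP[S0 Sn]; rewrite /f mulrDr mulr1.
  apply: le_trans (gnp_prob_U p01 (B := D S)
    (C := fun G => [exists q, (q \in setX S (~: S)) && F S q G]) _) _ => //.
  have Sn' : (#|S| <= n.-1)%N by lia.
  apply: lerD.
    rewrite /D gnp_prob_pattern ?sub0set ?cross_sub -?setI_eq0 ?set0I ?setICr //.
    rewrite cards0 mul1r card_cross -?setI_eq0 ?setICr //.
    apply: ler_wiXn2l => //; rewrite leq_mul2l; apply/orP; right.
    by have := cardsC S; rewrite card_ord; lia.
  apply: le_trans (gnp_prob_bigU p01 (Q := mem (setX S (~: S))) (E := F S) _) _.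
    by move=> G /existsP[q /andP[]]; exists q.
  have Fq q : q \in setX S (~: S) -> gnp_prob p (F S q) = r ^+ (#|S| * (n.-1 - #|S|)) * p.
    case: q => x v /setXP[/= xS]; rewrite inE => vS.
    have dS : [disjoint S & ~: (v |: S)].
      by rewrite disjoints_subset setCK subsetUr.
    have neq_xv : x != v by apply: contraNneq vS => <-.
    rewrite /F gnp_prob_pattern ?cross_sub //=; first last.
    - rewrite disjoints1; apply/imsetP => -[[a b] /setXP[/= aS]].
      rewrite !inE negb_or => /andP[bv bS] /setP eq_e.
      have := eq_e b; rewrite !inE eqxx (negPf bv) orbT orbF => /eqP bx.
      by rewrite bx xS in bS.
    - by rewrite sub1set inE cards2 neq_xv.
    rewrite cards1 expr1 mulrC card_cross //; congr (_ ^+ (_ * _) * _).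
    have := cardsC (v |: S); rewrite cardsU1 vS card_ord => /(canRL (addKn _)) ->.
    by rewrite subnDA subn1.
  rewrite (eq_bigr _ Fq) sumr_const cardsX -(mulr_natr (_ ^+ _ * p)) -mulrA.
  apply: ler_wpM2l; first exact: exprn_ge0.
  rewrite [p * _]mulrC; apply: ler_wpM2r => //; rewrite -natrM ler_nat leq_mul2l.
  by apply/orP; right; rewrite (leq_trans (max_card _)) ?card_ord.
apply: le_trans (ler_sum _ term) _.
(* As [#|S|] is at most [n], [inord] does not fall back on its default. *)
have inS (S : {set 'I_n}) : (inord #|S| : 'I_n.+1) = #|S| :> nat.
  by rewrite inordK // ltnS -[n in (_ <= n)%N]card_ord max_card.
rewrite (partition_big (fun S : {set 'I_n} => inord #|S| : 'I_n.+1)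
  (fun s : 'I_n.+1 => (0 < s)%N && (s.*2 < n)%N)) /=; last by move=> S; rewrite inS.
apply: ler_sum => s _.
rewrite (eq_bigr (fun=> f s)); last by move=> S /andP[_ /eqP <-]; rewrite inS.
rewrite sumr_const -(mulr_natl (f s)); apply: ler_wpM2r.
  by rewrite mulr_ge0 ?exprn_ge0 // addr_ge0 // !mulr_ge0.
rewrite ler_nat -[n in 'C(n, _)]card_ord -cardsT -cards_draws.
apply/subset_leq_card/subsetP => S; rewrite !inE => /andP[_ /eqP <-].
by rewrite subsetT inS eqxx.
Qed.
End Cuts.

(** * Asymptotics *)

From mathcomp Require Import all_classical all_reals all_analysis.
Import Order.TTheory GRing.Theory Num.Theory.
Import numFieldNormedType.Exports.
Local Open Scope classical_set_scope.
Local Open Scope ring_scope.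

(** * Error estimates of order 1 / log n *)

Lemma leq_bin_expn (n k : nat) : ('C(n, k) <= n ^ k)%N.
Proof.
elim: n k => [|n IHn] [|k]; rewrite ?bin0 ?bin0n ?expn0 // binS.
apply: leq_trans (leq_add (IHn k.+1) (IHn k)) _.
rewrite [(n ^ k.+1)%N]expnS addnC -mulSn expnS leq_mul2l.
by case: k => [|k]; rewrite ?expn0 ?orbT // leq_exp2r // leqnSn orbT.
Qed.

Lemma leq_bin_exp2 (n k : nat) : ('C(n, k) <= 2 ^ n)%N.
Proof.
elim: n k => [|n IHn] [|k]; rewrite ?bin0 ?bin0n ?expn_gt0 // binS expnS mul2n -addnn.
exact: leq_add.
Qed.

Section Estimates.
Variable R : realType.
Implicit Types (p eps : R) (n s : nat).
Local Notation L n := (ln (n%:R : R)).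

(** This turns a power saving exp(-c log n) into the rate 1 / log n. *)
Lemma expRN_le_inv (x : R) : 0 < x -> expR (- x) <= x^-1.
Proof.
move=> x0; rewrite expRN lef_pV2 ?posrE ?expR_gt0 //.
by have := expR_ge1Dx x; lra.
Qed.

Lemma expR_ln_nat n : (0 < n)%N -> expR (L n) = n%:R.
Proof. by move=> n0; rewrite lnK // posrE ltr0n. Qed.

Lemma ln_nat_pinfty (A : R) : \forall n \near \oo, A <= L n.
Proof.
near=> n; rewrite -ler_expR expR_ln_nat; last by near: n; exists 1%N.
by near: n; exact: nbhs_infty_ger.
Unshelve. all: by end_near. Qed.

(** With l = log n, squaring exp(l / 2) >= l / 2 gives n >= l^2 / 4. *)
Lemma ln_div_nat_le n : 0 < L n -> L n / n%:R <= 4%:R / L n.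
Proof.
move=> L0; have n0 : (0 < n)%N by case: n L0 => //; rewrite ln0 ?ltxx.
have nE : n%:R = expR (L n / 2) ^+ 2.
  by rewrite -expRM_natl -[LHS](expR_ln_nat n0); congr expR; field.
rewrite ler_pdivrMr ?ltr0n // mulrAC ler_pdivlMr // [in leRHS]nE.
have := expR_ge1Dx (L n / 2); move: L0; set E := expR _; set l := L n => L0 El.
have : 0 <= (E - l / 2) * (E + l / 2) by apply: mulr_ge0; lra.
by lra.
Qed.

(** Since 1 - p >= exp(-p / (1 - p)), the expected number of isolated vertices is at least n^(eps /
    2). *)
Lemma gnp_no_isolated_le n p eps :
    0 < eps <= 2^-1 -> 8%:R / eps <= L n ->
    0 <= p <= (1 - eps) * (L n / n%:R) ->
  gnp_prob p (fun G : sgraph 'I_n => ~~ [exists v, forall u, ~~ adj G v u]) <=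
    (2%:R / eps + 8%:R) / L n.
Proof.
move=> /andP[e0 e1] eL /andP[p0 pL].
have L0 : 0 < L n by apply: lt_le_trans eL; rewrite divr_gt0.
have n1 : (1 < n)%N by case: n {p pL p0 eL} L0 => [|[|//]]; [rewrite ln0 ?ltxx | rewrite ln1 ltxx].
have n0 : 0 < n%:R :> R by rewrite ltr0n ltnW.
have Ln0 : 0 <= L n / n%:R by rewrite divr_ge0 // ltW.
have pLn : p <= L n / n%:R by nra.
(* The constant 8 in the hypothesis is chosen to give [p <= eps / 2]. *)
have Le : 4%:R / L n <= eps / 2.
  by rewrite ler_pdivrMr //; move: eL; rewrite ler_pdivrMr //; lra.
have p4 : p <= 4%:R / L n := le_trans pLn (ln_div_nat_le L0).
have pe : p <= eps / 2 := le_trans p4 Le.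
have p1 : 0 <= p < 1 by lra.
apply: le_trans (gnp_no_isolated n1 p1) _; set r := 1 - p.
have r0 : 0 < r by rewrite /r; lra.
have r_exp : expR (- (p / r)) <= r.
  rewrite expRN -[leRHS]invrK lef_pV2 ?posrE ?expR_gt0 ?invr_gt0 //.
  apply: le_trans _ (expR_ge1Dx _); rewrite le_eqVlt; apply/orP; left; apply/eqP.
  by rewrite /r; field; rewrite gt_eqF.
(* As [p <= eps / 2], this comes down to 1 - eps <= (1 - eps / 2)^2. *)
have npL : n.-1%:R * (p / r) <= (1 - eps / 2) * L n.
  apply: (@le_trans _ _ (n%:R * (p / r))).
    by apply: ler_wpM2r; [rewrite divr_ge0 // ltW | rewrite ler_nat leq_pred].
  rewrite mulrA ler_pdivrMr //.
  have np : n%:R * p <= (1 - eps) * L n.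
    by move: pL; rewrite mulrA ler_pdivlMr // mulrC.
  apply: le_trans np _; rewrite mulrAC; apply: ler_wpM2r; first exact: ltW.
  by rewrite /r; nra.
have mu_ge : expR (eps / 2 * L n) <= n%:R * r ^+ n.-1.
  have -> : eps / 2 * L n = L n + - ((1 - eps / 2) * L n) by ring.
  rewrite expRD expR_ln_nat ?(ltnW n1) //; apply: ler_wpM2l; first exact: ltW.
  apply: (@le_trans _ _ (expR (n.-1%:R * - (p / r)))).
    by rewrite ler_expR mulrN lerN2.
  by rewrite expRM_natl lerXn2r // nnegrE ?expR_ge0 // ltW.
rewrite mulrDl; apply: lerD.
  apply: (@le_trans _ _ (expR (- (eps / 2 * L n)))).
    by rewrite expRN lef_pV2 ?posrE ?expR_gt0 // mulr_gt0 ?exprn_gt0.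
  have eL0 : 0 < eps / 2 * L n by rewrite mulr_gt0 ?divr_gt0.
  apply: le_trans (expRN_le_inv eL0) _; rewrite le_eqVlt; apply/orP; left; apply/eqP.
  by field; rewrite !gt_eqF.
rewrite ler_pdivrMr //; have : 8%:R / L n = 2 * (4%:R / L n) by ring.
by move=> ->; rewrite /r; nra.
Qed.

(** Both denominators are at least log n because n p >= log n; and 600 = 576 + 24. *)
Lemma gnp_no_triangle_le n p : 3 <= L n -> L n / n%:R <= p <= 1 ->
  gnp_prob p (fun G : sgraph 'I_n => ~~ [exists x, exists y, exists z, triangle G x y z])
    <= 600%:R / L n.
Proof.
move=> L3 /andP[Lp p1]; have L0 : 0 < L n by lra.
have n0 : (0 < n)%N by case: n {p Lp p1 L3} L0 => //; rewrite ln0 ?ltxx.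
have n0R : 0 < n%:R :> R by rewrite ltr0n.
have n3 : (3 < n)%N.
  rewrite -(ler_nat R) -(expR_ln_nat n0).
  by have := expR_ge1Dx (L n); lra.
have npL : L n <= n%:R * p by rewrite mulrC -ler_pdivrMr.
have p0 : 0 < p by apply: lt_le_trans Lp; rewrite divr_gt0.
apply: le_trans (gnp_no_triangle n3 _) _; first by rewrite p0.
have n1 : 1 <= n%:R :> R by rewrite ler1n.
have -> : 600%:R / L n = 576%:R / L n + 24%:R / L n by ring.
apply: lerD; (apply: ler_wpM2l; first exact: ler0n);
  rewrite lef_pV2 ?posrE ?exprn_gt0 ?mulr_gt0 ?exprn_gt0 //.
  by rewrite expr2 -mulrA; nra.
set y := n%:R * p in npL *; rewrite 2!exprS expr1.
have y3 : 3 <= y by lra.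
by nra.
Qed.

(* The factor 'C(n, s) is at most n^s, good for small s, and at most 2^n, good  *)
(* for s of order n; d^-1 absorbs 1 + s n p into the exponential.              *)
Lemma cut_term_le n s p eps (d := eps / 16%:R) :
    0 < eps <= 1 -> 8%:R / eps <= n%:R -> 0 < L n ->
    (1 + eps) * (L n / n%:R) <= p <= 1 -> (0 < s)%N -> (s.*2 < n)%N ->
  'C(n, s)%:R * ((1 - p) ^+ (s * (n.-1 - s)) * (1 + s%:R * n%:R * p)) <=
    d^-1 * (2 * expR d^-1 * expR (- (eps / 4%:R * L n))) ^+ s.
Proof.
move=> /andP[e0 e1] en L0 /andP[Lp p1] s0 sn.
have [n0 s_le s2n] : [/\ (0 < n)%N, (s <= n.-1)%N & ((s * 2).+1 <= n)%N].
  by clear -s0 sn; split; lia.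
have d0 : 0 < d by rewrite divr_gt0.
have n0R : 0 < n%:R :> R by rewrite ltr0n.
have p0 : 0 < p by apply: lt_le_trans Lp; rewrite mulr_gt0 ?divr_gt0 //; lra.
have npL : (1 + eps) * L n <= n%:R * p.
  by move: Lp; rewrite mulrA ler_pdivrMr // [p * _]mulrC.
have s1 : 1 <= s%:R :> R by rewrite ler1n.
have sn1 : s%:R * 2 <= n%:R - 1 :> R.
  by rewrite -natrM lerBrDr natr1 ler_nat.
(* This will absorb the -1 in [m]. *)
have en1 : 1 <= eps / 8%:R * n%:R by move: en; rewrite ler_pdivrMr //; lra.
pose m : R := n%:R - 1 - s%:R.
have rE : (1 - p) ^+ (s * (n.-1 - s)) <= expR (- (p * m)) ^+ s.
  have -> : m = (n.-1 - s)%:R.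
    by rewrite natrB // -subn1 natrB.
  rewrite mulnC exprM mulrC -mulrN expRM_natl.
  rewrite lerXn2r ?nnegrE ?exprn_ge0 ?expR_ge0 ?subr_ge0 //.
  rewrite lerXn2r ?nnegrE ?expR_ge0 ?subr_ge0 //.
  exact: expR_ge1Dx.
(* From s <= 2^s and, as d <= 1, 1 + y <= d^-1 exp(d y). *)
have facE : 1 + s%:R * n%:R * p <= d^-1 * (2 * expR (d * (n%:R * p))) ^+ s.
  have X1 : 1 <= expR (d * (n%:R * p)).
    by rewrite -{1}expR0 ler_expR; apply: mulr_ge0; [exact: ltW | rewrite mulr_ge0 // ltW].
  apply: (@le_trans _ _ (d^-1 * (2 ^+ s * expR (d * (n%:R * p))))); last first.
    rewrite exprMn; apply: ler_wpM2l; first by rewrite invr_ge0 ltW.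
    by apply: ler_wpM2l; [rewrite exprn_ge0 | rewrite -[leLHS]expr1 ler_weXn2l].
  have s2 : s%:R <= 2 ^+ s :> R by rewrite -natrX ler_nat ltnW // ltn_expl.
  apply: (@le_trans _ _ (2 ^+ s * (1 + n%:R * p))).
    have : 0 < n%:R * p by rewrite mulr_gt0.
    set y := n%:R * p; rewrite -mulrA -/y; nra.
  rewrite mulrCA; apply: ler_wpM2l; first by rewrite exprn_ge0.
  rewrite ler_pdivlMl //; apply: le_trans _ (expR_ge1Dx _).
  have d1 : d <= 1 by rewrite /d; lra.
  by rewrite mulrDr mulr1 lerD2r.
set q := 2 * _ * _.
suff binE : 'C(n, s)%:R * (expR (- (p * m)) * (2 * expR (d * (n%:R * p)))) ^+ s <= q ^+ s.
  apply: le_trans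
    (_ : _ <= d^-1 * ('C(n, s)%:R * (expR (- (p * m)) * (2 * expR (d * (n%:R * p)))) ^+ s)) _.
    rewrite [leRHS]mulrCA; apply: ler_wpM2l => //; rewrite exprMn [leRHS]mulrCA.
    by apply: ler_pM => //; rewrite ?exprn_ge0 ?subr_ge0 ?addr_ge0 ?mulr_ge0 // ltW.
  by apply: ler_wpM2l => //; rewrite invr_ge0 ltW.
have base : expR (- (p * m)) * (2 * expR (d * (n%:R * p))) = 2 * expR (- (p * (m - d * n%:R))).
  by rewrite mulrCA -expRD; congr (_ * expR _); ring.
rewrite base; have [sd|sd] := leP s%:R (d * n%:R).
  (* Small [s]: m - d n >= (1 - eps / 4) n, and (1 - eps / 4)(1 + eps) >= 1 + eps / 2 for eps <= 1.
     Against the factor n from the binomial, a saving of exp(-(eps / 2) log n) remains. *)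
  apply: (@le_trans _ _ (expR (L n) ^+ s * (2 * expR (- (p * (m - d * n%:R)))) ^+ s)).
    apply: ler_wpM2r; first by rewrite exprn_ge0 // mulr_ge0 ?expR_ge0.
    by rewrite expR_ln_nat // -natrX ler_nat leq_bin_expn.
  rewrite -exprMn lerXn2r ?nnegrE ?mulr_ge0 ?expR_ge0 //.
  rewrite /q mulrCA -mulrA; apply: ler_wpM2l => //; rewrite -!expRD ler_expR.
  have d1 : 0 < d^-1 by rewrite invr_gt0.
  have : p * ((1 - eps / 4%:R) * n%:R) <= p * (m - d * n%:R).
    apply: ler_wpM2l; first exact: ltW.
    by rewrite /m; move: sd; rewrite /d; lra.
  have : (1 - eps / 4%:R) * ((1 + eps) * L n) <= (1 - eps / 4%:R) * (n%:R * p).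
    by apply: ler_wpM2l => //; lra.
  have : 0 <= eps * L n * (1 - eps).
    by apply: mulr_ge0; [rewrite mulr_ge0 // ltW | rewrite subr_ge0].
  have : 0 <= eps * L n by rewrite mulr_ge0 // ltW.
  by set w := p * (m - _); lra.
(* Large [s]: n < s / d, so 2^n <= exp(s / d), while m - d n >= n / 4 because s < n / 2. *)
apply: (@le_trans _ _ (expR d^-1 ^+ s * (2 * expR (- (p * (m - d * n%:R)))) ^+ s)).
  apply: ler_wpM2r; first by rewrite exprn_ge0 // mulr_ge0 ?expR_ge0.
  apply: (@le_trans _ _ (2 ^+ n)); first by rewrite -natrX ler_nat leq_bin_exp2.
  apply: (@le_trans _ _ (expR 1 ^+ n)).
    by rewrite lerXn2r ?nnegrE ?expR_ge0 //; apply: le_trans _ (expR_ge1Dx _).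
  rewrite -!expRM_natl ler_expR mulr1 ler_pdivlMr // mulrC; exact: ltW.
rewrite -exprMn lerXn2r ?nnegrE ?mulr_ge0 ?expR_ge0 //.
rewrite /q mulrCA -mulrA; apply: ler_wpM2l => //; apply: ler_wpM2l; first exact: expR_ge0.
rewrite ler_expR lerN2.
have : p * (n%:R / 4%:R) <= p * (m - d * n%:R).
  apply: ler_wpM2l; first exact: ltW.
  by rewrite /m /d; nra.
by nra.
Qed.

Lemma sum_expr_le (q : R) m : 0 <= q <= 2^-1 -> \sum_(s < m) q ^+ s.+1 <= 2 * q.
Proof.
(* The subtracted term makes the induction close. *)
move=> /andP[q0 q2]; suff : \sum_(s < m) q ^+ s.+1 <= 2 * q - 2 * q ^+ m.+1.
  by have := exprn_ge0 m.+1 q0; lra.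
elim: m => [|m IHm]; first by rewrite big_ord0 expr1 subrr.
rewrite big_ord_recr /=; have : q * q ^+ m.+1 <= 2^-1 * q ^+ m.+1.
  by apply: ler_wpM2r; rewrite ?exprn_ge0.
by rewrite [q ^+ m.+2]exprS; lra.
Qed.

(** [K] is chosen so that the ratio of the geometric series is at most K / log n, hence at most 1 /
    2. *)
Lemma gnp_cut_le n p eps (d := eps / 16%:R) (K := 8%:R * expR d^-1 / eps) :
    0 < eps <= 1 -> 8%:R / eps <= n%:R -> 2 * K <= L n ->
    (1 + eps) * (L n / n%:R) <= p <= 1 ->
  gnp_prob p (fun G : sgraph 'I_n => ~~ cut_freeb G) <= 2 * K / d / L n.
Proof.
move=> e01 en KL Lp; have /andP[e0 _] := e01.
have K0 : 0 < K by rewrite divr_gt0 ?mulr_gt0 ?expR_gt0.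
have d0 : 0 < d by rewrite divr_gt0.
have L0 : 0 < L n by apply: lt_le_trans KL; rewrite mulr_gt0.
have p01 : 0 <= p <= 1.
  case/andP: Lp => Lp ->; rewrite andbT; apply: le_trans Lp.
  by rewrite mulr_ge0 ?divr_ge0 ?addr_ge0 // ltW.
apply: le_trans (gnp_cut n p01) _.
set q := 2 * expR d^-1 * expR (- (eps / 4%:R * L n)).
have q0 : 0 <= q by rewrite !mulr_ge0 ?expR_ge0.
have qL : q <= K / L n.
  have -> : K / L n = 2 * expR d^-1 * (eps / 4%:R * L n)^-1.
    by rewrite /K; field; rewrite !gt_eqF.
  apply: ler_wpM2l; first by rewrite mulr_ge0 ?expR_ge0.
  by apply: expRN_le_inv; rewrite mulr_gt0 ?divr_gt0.
have q2 : q <= 2^-1.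
  by apply: le_trans qL _; rewrite ler_pdivrMr //; lra.
apply: (@le_trans _ _ (\sum_(s < n.+1 | (0 < s)%N) d^-1 * q ^+ s)).
  rewrite [leRHS](bigID (fun s : 'I_n.+1 => (s.*2 < n)%N)) /= -[leLHS]addr0.
  apply: lerD; last by apply: sumr_ge0 => s _; rewrite mulr_ge0 ?invr_ge0 ?exprn_ge0 // ltW.
  by apply: ler_sum => s /andP[s0 sn]; apply: cut_term_le.
rewrite -mulr_sumr big_mkcond big_ord_recl /= add0r.
have -> : 2 * K / d / L n = d^-1 * (2 * (K / L n)) by field; rewrite !gt_eqF.
apply: ler_wpM2l; first by rewrite invr_ge0 ltW.
apply: le_trans (sum_expr_le n _) _; first by rewrite q0.
by apply: ler_wpM2l.
Qed.

(** Probabilities are at most 1, so only the deviation from below needs a rate. *)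
Lemma cvg1_of_ln_rate (C : R) (f : nat -> R) :
    0 < C -> (forall n, f n <= 1) -> (\forall n \near \oo, 1 - f n <= C / L n) ->
  f n @[n --> \oo] --> (1 : R).
Proof.
move=> C0 f1 fC; apply/cvgrPdist_le => e e0; near=> n.
rewrite ger0_norm ?subr_ge0 //.
have CL : C / e <= L n by near: n; exact: ln_nat_pinfty.
have L0 : 0 < L n by apply: lt_le_trans CL; rewrite divr_gt0.
apply: (@le_trans _ _ (C / L n)); first by near: n.
by rewrite ler_pdivrMr // mulrC -ler_pdivrMr.
Unshelve. all: by end_near. Qed.

End Estimates.

(** * The two sides of the threshold *)

Lemma gnp_FS_disconnected (R : realType) (k n : nat) (p : R) (eps : R) :
    (1 < n)%N -> 0 < eps <= 2^-1 -> 8%:R / eps <= ln n%:R ->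
    0 <= p <= 1 -> p <= (1 - eps) * (ln n%:R / n%:R) ->
  1 - gnp_prob p (fun Y : sgraph 'I_n => ~~ gconnected (FS (Kbip k n) Y)) <=
    (2%:R / eps + 8%:R) / ln n%:R.
Proof.
move=> n1 e01 eL p01 pL; have /andP[p0 _] := p01.
apply: le_trans _ (gnp_no_isolated_le e01 eL (p := p) _); last by rewrite p0.
rewrite -gnp_probC; apply: gnp_prob_le => // G; apply: contraNN.
move=> /existsP[v /forallP iso_v].
by apply: isolated_FS_disconnected iso_v; rewrite card_ord.
Qed.

Lemma gnp_FS_connected (R : realType) (k n : nat) (p : R) (eps : R)
    (d := eps / 16%:R) (K := 8%:R * expR d^-1 / eps) :
    (0 < k < n)%N -> 0 < eps <= 1 -> 8%:R / eps <= n%:R ->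
    3 <= ln (n%:R : R) -> 2 * K <= ln n%:R ->
    (1 + eps) * (ln n%:R / n%:R) <= p <= 1 ->
  1 - gnp_prob p (fun Y : sgraph 'I_n => gconnected (FS (Kbip k n) Y)) <=
    (600%:R + 2 * K / d) / ln n%:R.
Proof.
move=> kn e01 en L3 KL /andP[Lp p1]; have /andP[e0 _] := e01.
have Ln0 : 0 <= ln (n%:R : R) / n%:R by rewrite divr_ge0 //; lra.
have Lp1 : ln n%:R / n%:R <= p by apply: le_trans Lp; nra.
have p01 : 0 <= p <= 1 by rewrite p1 (le_trans Ln0).
rewrite -gnp_probC mulrDl.
apply: le_trans (gnp_prob_U p01 _) (lerD (gnp_no_triangle_le L3 _) (gnp_cut_le e01 en KL _)).
- move=> G; apply: contraR; rewrite negb_or !negbK.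
  move=> /andP[/existsP[x /existsP[y /existsP[z xyz]]] /cut_freebP cutG].
  exact: gconnected_FS_Kbip xyz cutG.
- by rewrite Lp1.
by rewrite Lp.
Qed.

Theorem theorem1p6 (R : realType) (k : nat) (hk : (1 <= k)%N) (eps : R)
    (heps : 0 < eps) (p : nat -> R) (hp : forall n : nat, 0 <= p n <= 1) :
  ((\forall n \near \oo, p n <= (1 - eps) * (ln n%:R / n%:R)) ->
     gnp_prob (p n) (fun Y : sgraph 'I_n => ~~ gconnected (FS (Kbip k n) Y))
       @[n --> \oo] --> (1 : R))
  /\
  ((\forall n \near \oo, (1 + eps) * (ln n%:R / n%:R) <= p n) ->
     gnp_prob (p n) (fun Y : sgraph 'I_n => gconnected (FS (Kbip k n) Y))
       @[n --> \oo] --> (1 : R)).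
Proof.
split=> p_near.
  have [e [e01 e_le]] : exists e : R, 0 < e <= 2^-1 /\ e <= eps.
    exists (Num.min eps 2^-1).
    by rewrite lt_min heps invr_gt0 ltr0n !ge_min !lexx orbT.
  have /andP[e0 _] := e01.
  apply: (@cvg1_of_ln_rate R (2%:R / e + 8%:R)).
  - by rewrite addr_gt0 ?divr_gt0.
  - by move=> n; apply: gnp_prob_le1.
  near=> n.
  have eL : 8%:R / e <= ln n%:R by near: n; exact: ln_nat_pinfty.
  have L0 : 0 <= ln (n%:R : R) / n%:R.
    by rewrite divr_ge0 // (le_trans _ eL) // divr_ge0 // ltW.
  have pn : p n <= (1 - eps) * (ln n%:R / n%:R) by near: n.
  apply: gnp_FS_disconnected => //; first by near: n; exists 2%N.
  by apply: le_trans pn _; apply: ler_wpM2r; rewrite // lerD2l lerN2.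
have [e [e01 e_le]] : exists e : R, 0 < e <= 1 /\ e <= eps.
  by exists (Num.min eps 1); rewrite lt_min heps ltr01 !ge_min !lexx orbT.
have /andP[e0 _] := e01.
set K := 8%:R * expR (e / 16%:R)^-1 / e.
have K0 : 0 < K by rewrite divr_gt0 ?mulr_gt0 ?expR_gt0.
apply: (@cvg1_of_ln_rate R (600%:R + 2 * K / (e / 16%:R))).
- apply: addr_gt0; first by rewrite ltr0n.
  by apply: divr_gt0; [exact: mulr_gt0 | exact: divr_gt0].
- by move=> n; apply: gnp_prob_le1.
near=> n.
have L3 : 3 <= ln (n%:R : R) by near: n; exact: ln_nat_pinfty.
have L0 : 0 <= ln (n%:R : R) / n%:R by rewrite divr_ge0 // (le_trans _ L3).
have pn : (1 + eps) * (ln n%:R / n%:R) <= p n by near: n.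
apply: gnp_FS_connected => //.
- by rewrite hk /=; near: n; exists k.+1.
- by near: n; exact: nbhs_infty_ger.
- by near: n; exact: ln_nat_pinfty.
have /andP[_ ->] := hp n; rewrite andbT; apply: le_trans pn.
by apply: ler_wpM2r; rewrite // lerD2l.
Unshelve. all: by end_near. Qed.
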